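(* Let $V$ and $W$ be the tiling space and window space (projection direction) of a nonperiodic one-dimensional tiling with an interval projection structure, with window $\Omega$. This projection tiling admits a substitution rule if and only if $V$ and $W$ are respectively the expanding and contracting eigenspaces of a primitive matrix $M\in Gl(2,\mathbb{Z})$ and the window length $|\Omega|$ lies in $\mathbb{Q}[\lambda]$, where $\lambda$ is the expanding eigenvalue of $M$.
   Context: Interval projection tilings. $V,W\subset\mathbb{R}^2$ are two distinct lines through the origin, neither parallel to a coordinate axis. $Y=\{0\}\times\mathbb{R}$ is the vertical axis, identified with $\mathbb{R}$. $\Pi_V$ is the projection of $\mathbb{R}^2$ onto $V$ parallel to $W$. The window $\Omega\subset Y$ is a bounded half-open interval of length $|\Omega|$. The one-dimensional tiling with interval projection structure determined by $V,W,\Omega$ is the tiling of the line $V$ by intervals whose set of vertices (endpoints of tiles) is $\Pi_V(\mathbb{Z}^2\cap(V+\Omega))$. It is a purely geometric object (a partition of the line into intervals, without labels); ''nonperiodic'' refers to this geometric tiling. Substitution rules. Given a finite protoset of labelled prototiles (intervals, each with a length and a label), a substitution rule consists of a factor $\lambda_0>1$ together with a replacement rule assigning to each inflated prototile (scaled by $\lambda_0$) a finite patch of translated prototiles that covers it exactly. It acts on a labelled tiling by first inflating it uniformly by $\lambda_0$ and then replacing every inflated tile according to its label. Two tilings are locally isomorphic if every finite patch of one occurs (up to translation) in the other, and conversely. A labelled tiling $\mathcal{T}$ is a substitution tiling for the substitution rule $\sigma$ if for every $n\in\mathbb{N}$ there is a tiling $\mathcal{T}'$ locally isomorphic to $\mathcal{T}$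 with $\sigma^n\mathcal{T}'=\mathcal{T}$. A geometric tiling admits a substitution rule if there is a labelling of its tiles with finitely many labels (tiles of different lengths never receiving the same label) such that the labelled tiling is a substitution tiling for some substitution rule on the labelled protoset. Algebra. $Gl(2,\mathbb{Z})$ is the group of $2\times2$ integer matrices with determinant $\pm1$. $M\in Gl(2,\mathbb{Z})$ is primitive if there is $n\in\mathbb{N}$ such that all entries of $M^n$ are nonzero. The expanding (contracting) eigenvalue is the one of absolute value $>1$ ($<1$). $\mathbb{Q}[\lambda]=\mathbb{Q}+\lambda\mathbb{Q}$. *)

(* Defs.v *)
From mathcomp Require Import all_boot all_order all_algebra.
From mathcomp Require Import all_classical reals.

Set Implicit Arguments.
Unset Strict Implicit.
Unset Printing Implicit Defensive.

Import Order.TTheory GRing.Theory Num.Theory.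
Local Open Scope classical_set_scope.
Local Open Scope ring_scope.

Record protoset (R : realType) := Protoset {
  label : finType;
  len : label -> R;
  len_gt0 : forall l, 0 < len l }.

Section Tilings.
Variables (R : realType) (P : protoset R).

(* The labelled tile (x, l) occupies the interval [x, x + len l]; since its
   length is a function of its label, tiles of different lengths never share
   a label. *)
Definition ltile : Type := (R * label P)%type.

Definition left_end (p : ltile) : R := p.1.
Definition right_end (p : ltile) : R := p.1 + len p.2.

Definition tiles_exactly (T : set ltile) (A : set R) : Prop :=
  \bigcup_(p in T) `[left_end p, right_end p]%classic = A /\
  forall p q, T p -> T q -> p <> q ->
    `]left_end p, right_end p[%classic `&` `]left_end q, right_end q[%classic
      = set0.

Definition tiling (T : set ltile) : Prop := tiles_exactly T [set: R].

Definition vertices (T : set ltile) : set R :=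
  left_end @` T `|` right_end @` T.

Definition translate (t : R) (T : set ltile) : set ltile :=
  [set (p.1 + t, p.2) | p in T].

Definition patches_occur (T1 T2 : set ltile) : Prop :=
  forall F : set ltile, finite_set F -> F `<=` T1 ->
    exists t : R, translate t F `<=` T2.

Definition locally_isomorphic (T1 T2 : set ltile) : Prop :=
  patches_occur T1 T2 /\ patches_occur T2 T1.

Record substitution_rule := SubstitutionRule {
  factor : R;
  factor_gt1 : 1 < factor;
  replacement : label P -> set ltile;
  replacement_finite : forall l, finite_set (replacement l);
  replacement_exact : forall l,
    tiles_exactly (replacement l) `[0, factor * len l]%classic }.

(* [replacement s l] replaces the inflated tile with left end 0; the inflation
   of (x, l) has its left end at [factor s * x]. *)
Definition substitute (s : substitution_rule) (T : set ltile) : set ltile :=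
  \bigcup_(p in T) translate (factor s * p.1) (replacement s p.2).

Definition substitution_tiling (s : substitution_rule) (T : set ltile) : Prop :=
  forall n : nat, exists T' : set ltile,
    [/\ tiling T', locally_isomorphic T T' & iter n (substitute s) T' = T].

End Tilings.

Definition nonperiodic (R : realType) (X : set R) : Prop :=
  forall t : R, t != 0 -> [set x + t | x in X] <> X.

(* A tiling of the line by intervals is given by its set X of vertices; a
   labelling of it is a labelled tiling with the same vertices. *)
Definition admits_substitution (R : realType) (X : set R) : Prop :=
  exists (P : protoset R) (T : set (ltile P)) (s : substitution_rule P),
    [/\ tiling T, vertices T = X & substitution_tiling s T].

Section Projection.
Variable R : realType.

Definition e_x : 'cV[R]_2 := delta_mx 0 0.
Definition e_y : 'cV[R]_2 := delta_mx 1 0.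

Definition is_line (V : {vspace 'cV[R]_2}) : Prop := \dim V = 1%N.

Definition axis_parallel (V : {vspace 'cV[R]_2}) : Prop :=
  V = <[e_x]>%VS \/ V = <[e_y]>%VS.

Definition Z2 : set 'cV[R]_2 := range (map_mx (intr : int -> R)).

Definition strip (V : {vspace 'cV[R]_2}) (Omega : set R) : set 'cV[R]_2 :=
  [set v + y *: e_y | v in [set v | v \in V] & y in Omega].

(* [daddv_pi V W] is the projection onto V parallel to W. *)
Definition projection_vertices (V W : {vspace 'cV[R]_2}) (Omega : set R) :
    set 'cV[R]_2 :=
  daddv_pi V W @` (Z2 `&` strip V Omega).

Definition unit_vector (v : 'cV[R]_2) : Prop := \sum_i v i 0 ^+ 2 = 1.

(* The projection tiling read off in R through the isometry t |-> t *: v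
   from R onto V, where v is a unit vector of V. *)
Definition projection_tiling (V W : {vspace 'cV[R]_2}) (Omega : set R)
    (v : 'cV[R]_2) : set R :=
  [set t | projection_vertices V W Omega (t *: v)].

Definition GL2Z (M : 'M[int]_2) : Prop := \det M = 1 \/ \det M = -1.

Definition primitive_mx (M : 'M[int]_2) : Prop :=
  exists n : nat, forall i j, (M ^+ n) i j != 0.

Definition real_action (M : 'M[int]_2) : 'End('cV[R]_2) :=
  linfun (mulmx (map_mx (intr : int -> R) M)).

Definition expanding_eigenvalue (M : 'M[int]_2) (lambda : R) : Prop :=
  passmx.leigenvalue (real_action M) lambda /\ 1 < `|lambda|.

Definition contracting_eigenvalue (M : 'M[int]_2) (mu : R) : Prop :=
  passmx.leigenvalue (real_action M) mu /\ `|mu| < 1.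

Definition Q_adjoin (lambda : R) : set R :=
  [set ratr p + lambda * ratr q | p in [set: rat] & q in [set: rat]].

End Projection.

(* Main.v *)
Require Import Defs.
From HB Require Import structures.
From mathcomp Require Import all_boot all_order all_algebra.
From mathcomp Require Import all_classical reals.
From mathcomp Require Import ring lra zify.

Set Implicit Arguments.
Unset Strict Implicit.
Unset Printing Implicit Defensive.

Import Order.TTheory GRing.Theory Num.Theory.
Local Open Scope classical_set_scope.
Local Open Scope ring_scope.

(** Let [s x] be the position on the line [V] of the projection of a lattice
    point [x], and [y x] the height at which the parallel to [V] through [x]
    meets the vertical axis. Both are linear forms on Z^2, the vertices of the
    tiling are the [s x] with [y x] in the window, and nonperiodicity means
    that [y] is injective on Z^2; its values are then dense. Reversing the sign
    of [y] exchanges the two kinds of half-open window, so that the window may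
    be taken to be [a <= y x < b], of length [L = b - a]. The eigenspace
    condition says that [s (M x) = lam * s x] and [y (M x) = mu * y x].

    Sufficiency. After squaring [M], [lam > 1] and [0 < mu < 1]. Scaling by
    [lam] carries the vertices for a window to the vertices for the window
    scaled by [mu], which are among the vertices for any window that contains
    the latter. Hence every inflated tile is a union of tiles. How it is divided
    depends on the height [u] of its starting vertex above the lower end of the
    window, through comparisons of [mu * u] with heights of lattice points and
    with these heights displaced by [L]. If [kap * L] is a value of [y], all of
    them are comparisons of [kap * u] with values [y p]. A tile is labelled by
    these comparisons for the finitely many relevant [p] with [s p] bounded by a
    constant. To know the labels of the constituents of an inflated tile, the
    points [p] have to be pulled back by [M]; this divides [s p] by [lam], so a
    suitable constant reproduces itself ([agree_inflate]). Tilings whose windows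
    have the same length are locally isomorphic, and the substitution changes
    only the position of the window, which yields preimages of every order
    ([window_substitution_tiling]).

    Necessity. Every finite patch of the tiling can be inflated [n] times
    inside the tiling, up to a translation ([inflate_patch]). Comparing two
    vertices shows that multiplication by [lam] maps the group of values of [s]
    to itself, and that [lam ^ n * s m] is the value of [s] at a vector of
    height less than [L], in absolute value, if [m] is such a vector. The form
    [s] is injective ([form_injective]), so inflation is given by an integer
    matrix [M], and boundedness of the heights along orbits forces [y (M x) =
    mu * y x] with [mu] the other eigenvalue ([conjugate_form]). The
    determinant and the length of the window are found by counting. Encode a
    vertex by the labels of the tiles in a fixed length to its right; there are
    finitely many codes, and vertices with the same code start congruent
    patches after any number [n] of inflations. These patches change when the
    height of the vertex crosses one of the points where some lattice point
    enters or leaves the strip. Thus such discontinuities, for all [n]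
    together, occupy boundedly many places in the window
    ([finitely_many_discontinuities]). If [abs (det M) > 1], then the lattices
    M^(-n) Z^2 become dense and there are too many discontinuities for large
    [n] ([inflation_unimodular]). For every [n], the upper and the lower end of
    the window cause discontinuities whose difference is [L / mu ^ n] modulo
    the values of [y]. Two values of [n] produce the same difference, so that
    [(mu ^ -n - mu ^ -n') * L] is a value of [y]
    ([window_length_relation]); dividing by a nonzero element of Q(lam) places
    [L] in Q(lam). *)

(** * Linear forms on the lattice Z^2 *)

Notation lattice := ('cV[int]_2).

Definition ux : lattice := delta_mx 0 0.
Definition uy : lattice := delta_mx 1 0.

Lemma ord2E (i : 'I_2) : i = 0 \/ i = 1.
Proof. by case: i => [[|[|//]] Hi]; [left|right]; exact: val_inj. Qed.

Lemma latticeE (x : lattice) :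
  x = ux *~ x 0 0 + uy *~ x 1 0.
Proof.
apply/matrixP => i j; rewrite !(ord1 j) -!scaler_int !mxE.
by case: (ord2E i) => ->; rewrite /= ?mulr1 ?mulr0 ?addr0 ?add0r ?intz.
Qed.

Lemma floor_bounds (R : realType) (x : R) :
  (Num.floor x)%:~R <= x < (Num.floor x)%:~R + 1.
Proof. by have := floor_itv x; rewrite intrD. Qed.

Lemma natr_exceeds (R : realType) (x : R) : exists2 n : nat, (0 < n)%N & x < n%:R.
Proof.
exists (Num.trunc `|x|).+1 => //.
by apply: le_lt_trans (ler_norm x) _; rewrite truncnS_gt.
Qed.

Lemma bounded_ints (R : realType) (C : R) :
  exists F : seq int, forall i : int, `|i%:~R| <= C -> i \in F.
Proof.
have [K _ CK] := natr_exceeds C.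
exists [seq (k%:Z - K%:Z) | k <- iota 0 (2 * K).+1] => i.
rewrite -intr_norm => /le_lt_trans/(_ CK).
rewrite -[K%:R]/(K%:~R) ltr_int => iK.
apply/mapP; exists (absz (i + K%:Z)); last by lia.
by rewrite mem_iota; lia.
Qed.

(** Two of the fractional parts of [0], [alpha], ..., [Q * alpha] lie in the
    same one of [Q] boxes. *)
Lemma dirichlet (R : realType) (alpha : R) (Q : nat) : (0 < Q)%N ->
  exists p q : int,
    [/\ 0 < q, q <= Q & `|q%:~R * alpha - p%:~R| <= Q%:R^-1].
Proof.
move=> Q0; have Q0R : 0 < Q%:R :> R by rewrite ltr0n.
pose fr (k : nat) : R := k%:R * alpha - (Num.floor (k%:R * alpha))%:~R.
have frP k : 0 <= fr k < 1.
  by have := floor_bounds (k%:R * alpha); rewrite /fr; lra.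
pose bx (k : nat) : nat := Num.trunc (Q%:R * fr k).
have bxP k : (bx k)%:R <= Q%:R * fr k < (bx k).+1%:R.
  apply: truncn_itv; apply: mulr_ge0; first exact: ltW.
  by case/andP: (frP k).
have bxlt k : (bx k < Q)%N.
  rewrite -(ltr_nat R); have /andP[+ _] := bxP k; move/le_lt_trans; apply.
  by rewrite gtr_pMr //; case/andP: (frP k).
have [k [k' [kk' kQ eqb]]] : exists k k' : nat,
    [/\ (k < k')%N, (k' <= Q)%N & bx k = bx k'].
  pose h (k : 'I_Q.+1) : 'I_Q := Ordinal (bxlt k).
  have : ~ injective h by move/leq_card; rewrite !card_ord ltnn.
  move=> /existsNP[k /existsNP[k' /not_implyP[/(congr1 val)/= hkk' nkk']]].
  case: (ltngtP k k') => [lt|lt|/val_inj//].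
    by exists k, k'; split => //; rewrite -ltnS.
  by exists k', k; split => //; rewrite -ltnS.
exists (Num.floor (k'%:R * alpha) - Num.floor (k%:R * alpha)), (k' - k)%N%:Z.
split; [by lia|by lia|].
have -> : ((k' - k)%N%:Z)%:~R * alpha - (Num.floor (k'%:R * alpha)
    - Num.floor (k%:R * alpha))%:~R = fr k' - fr k :> R.
  by rewrite /fr -[(k' - k)%N%:~R]/((k' - k)%N%:R) natrB 1?ltnW // intrB; ring.
rewrite -(ler_pM2l Q0R) mulfV ?gt_eqF // -(gtr0_norm Q0R) -normrM.
have := bxP k; have := bxP k'; rewrite -eqb -natr1.
move: (fr k) (fr k') => u u' A B.
by rewrite ler_norml; lra.
Qed.

Section LinearForms.
Variable R : realType.
Implicit Types f : {additive lattice -> R}.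

Lemma formE f x :
  f x = f ux * (x 0 0)%:~R + f uy * (x 1 0)%:~R.
Proof. by rewrite {1}(latticeE x) raddfD !raddfMz !mulrzr. Qed.

Definition form_det f g : R :=
  f ux * g uy - f uy * g ux.

Variables s y : {additive lattice -> R}.
Hypothesis sy_det : form_det s y != 0.

Lemma finite_box (B : R) : exists F : seq lattice,
  forall x, `|s x| <= B -> `|y x| <= B -> x \in F.
Proof.
move: sy_det; rewrite /form_det.
set s0 := s ux; set s1 := s uy; set y0 := y ux; set y1 := y uy => D0.
set D := s0 * y1 - s1 * y0 in D0.
have [F FP] := bounded_ints (B * (`|y1| + `|s1|) / `|D|).
have [G GP] := bounded_ints (B * (`|y0| + `|s0|) / `|D|).
exists [seq ux *~ i + uy *~ j | i <- F, j <- G] => x sB yB.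
rewrite (latticeE x); apply: allpairs_f.
  apply: FP; rewrite ler_pdivlMr ?normr_gt0 // -normrM.
  have -> : (x 0 0)%:~R * D = s x * y1 - y x * s1.
    by rewrite (formE s x) (formE y x) -/s0 -/s1 -/y0 -/y1 /D; ring.
  rewrite mulrDr (le_trans (ler_normB _ _)) // !normrM.
  by apply: lerD; apply: ler_wpM2r.
apply: GP; rewrite ler_pdivlMr ?normr_gt0 // -normrM.
have -> : (x 1 0)%:~R * D = y x * s0 - s x * y0.
  by rewrite (formE s x) (formE y x) -/s0 -/s1 -/y0 -/y1 /D; ring.
rewrite mulrDr [leRHS]addrC (le_trans (ler_normB _ _)) // !normrM.
by apply: lerD; apply: ler_wpM2r.
Qed.

Lemma forms_eq0 x : s x = 0 -> y x = 0 -> x = 0.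
Proof.
move: sy_det; rewrite /form_det.
rewrite (formE s x) (formE y x).
set s0 := s ux; set s1 := s uy; set y0 := y ux; set y1 := y uy => D0 sx yx.
rewrite (latticeE x).
have /eqP : (x 0 0)%:~R * (s0 * y1 - s1 * y0) = 0.
  rewrite [LHS](_ : _ = (s0 * (x 0 0)%:~R + s1 * (x 1 0)%:~R) * y1
    - (y0 * (x 0 0)%:~R + y1 * (x 1 0)%:~R) * s1); last by ring.
  by rewrite sx yx !mul0r subr0.
rewrite mulf_eq0 (negPf D0) orbF intr_eq0 => /eqP ->.
have /eqP : (x 1 0)%:~R * (s0 * y1 - s1 * y0) = 0.
  rewrite [LHS](_ : _ = (y0 * (x 0 0)%:~R + y1 * (x 1 0)%:~R) * s0
    - (s0 * (x 0 0)%:~R + s1 * (x 1 0)%:~R) * y0); last by ring.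
  by rewrite sx yx !mul0r subr0.
by rewrite mulf_eq0 (negPf D0) orbF intr_eq0 => /eqP ->; rewrite !mulr0z addr0.
Qed.

End LinearForms.

Section Density.
Variables (R : realType) (y : {additive lattice -> R}).
Hypothesis y_inj : forall x, y x = 0 -> x = 0.

(** Dirichlet's theorem for the slope of the kernel of [y]. *)
Lemma small_vector (s : {additive lattice -> R}) :
  exists2 C : R, 0 < C & forall Q : nat, (0 < Q)%N -> exists x,
    [/\ x != 0, `|y x| <= C / Q%:R & `|s x| <= C * Q%:R].
Proof.
set s0 := s ux; set s1 := s uy.
set y0 := y ux; set y1 := y uy.
have y1n0 : y1 != 0.
  apply/eqP => /y_inj/matrixP/(_ 1 0); rewrite !mxE /=.
  by move/eqP; rewrite oner_eq0.
pose al := - y0 / y1.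
pose C := `|y1| + `|s0| + `|s1| * (`|al| + 1).
exists C.
  rewrite /C; have : 0 < `|y1| by rewrite normr_gt0.
  have : 0 <= `|s0| by []. 
  have : 0 <= `|s1| * (`|al| + 1) by rewrite mulr_ge0 // addr_ge0.
  by lra.
move=> Q Q0; have Q0R : 0 < Q%:R :> R by rewrite ltr0n.
have Q1R : 1 <= Q%:R :> R by rewrite ler1n.
have [p [q [q0 qQ pq]]] := dirichlet al Q0.
pose x : lattice := ux *~ q + uy *~ p.
have xE (f : {additive lattice -> R}) :
  f x = f ux * q%:~R + f uy * p%:~R.
  by rewrite /x raddfD !raddfMz !mulrzr.
have q0R : 0 < q%:~R :> R by rewrite ltr0z.
have qQR : q%:~R <= Q%:R :> R by rewrite -[Q%:R]/(Q%:~R) ler_int.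
exists x; split.
- apply/eqP => /matrixP/(_ 0 0); rewrite /x -!scaler_int !mxE /= mulr1 mulr0.
  by rewrite addr0 intz => q00; rewrite q00 in q0.
- have -> : y x = - y1 * (q%:~R * al - p%:~R).
    by rewrite xE -/y0 -/y1 /al; field.
  rewrite normrM normrN ler_pM // (le_trans _ (lexx _)) // /C.
  have : 0 <= `|s0| by []. 
  have : 0 <= `|s1| * (`|al| + 1) by rewrite mulr_ge0 // addr_ge0.
  by lra.
- rewrite xE -/s0 -/s1 (le_trans (ler_normD _ _)) // !normrM.
  rewrite (gtr0_norm q0R).
  have pB : `|p%:~R| <= (`|al| + 1) * Q%:R.
    have -> : p%:~R = q%:~R * al - (q%:~R * al - p%:~R) :> R by ring.
    rewrite (le_trans (ler_normB _ _)) // normrM (gtr0_norm q0R) mulrDl mul1r.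
    apply: lerD; first by rewrite mulrC ler_wpM2l.
    rewrite (le_trans pq) // (le_trans _ Q1R) // invf_le1 //.
  have A1 : `|s0| * q%:~R <= `|s0| * Q%:R by rewrite ler_wpM2l.
  have A2 : `|s1| * `|p%:~R| <= `|s1| * ((`|al| + 1) * Q%:R).
    by rewrite ler_wpM2l.
  rewrite /C !mulrDl -mulrA -!addrA.
  have : 0 <= `|y1| * Q%:R by rewrite mulr_ge0 // ltW.
  by lra.
Qed.

Lemma small_value (e : R) : 0 < e -> exists x, 0 < y x < e.
Proof.
move=> e0; have [C C0 CP] := small_vector y.
have [Q Q0 QP] := natr_exceeds (C / e).
have [x [x0 yx _]] := CP Q Q0.
have yxe : `|y x| < e.
  apply: le_lt_trans yx _; rewrite ltr_pdivrMr ?ltr0n //.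
  by rewrite mulrC -ltr_pdivrMr.
have yn0 : y x != 0 by apply: contra x0 => /eqP/y_inj ->.
case: (ltrP 0 (y x)) => yx0.
  by exists x; rewrite yx0 (le_lt_trans (ler_norm _) yxe).
exists (- x); rewrite raddfN oppr_gt0 lt_neqAle yn0 yx0 /=.
by rewrite (le_lt_trans _ yxe) // -normrN ler_norm.
Qed.

Lemma dense_values (c d : R) : c < d -> exists x, c < y x < d.
Proof.
move=> cd; have [|g /andP[g0 ge]] := small_value (e := d - c).
  by rewrite subr_gt0.
exists (g *~ (Num.floor (c / y g) + 1)).
rewrite raddfMz -mulrzl intrD.
have := floor_bounds (c / y g).
set k := (Num.floor _)%:~R => /andP[k1 k2].
have : k * y g <= c by rewrite -ler_pdivlMr.
have : c < (k + 1) * y g by rewrite -ltr_pdivrMr.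
by rewrite mulrDl; lra.
Qed.

(** Since the quotient of [y x] by a large integer [k] can be approximated by a
    value of [y], a subgroup that contains all vectors on which [y] is small is
    the whole lattice. *)
Lemma small_generate (L : R) (x : lattice) : 0 < L ->
  exists (k : nat) (m r : lattice),
    [/\ x = m *+ k + r, `|y m| < L & `|y r| < L].
Proof.
move=> L0; have [k k0 kP] := natr_exceeds (2 * `|y x| / L).
have k0R : 0 < k%:R :> R by rewrite ltr0n.
have k1R : 1 <= k%:R :> R by rewrite ler1n.
have [|m /andP[m1 m2]] :=
  dense_values (c := y x / k%:R - L / (2 * k%:R)) (d := y x / k%:R + L / (2 * k%:R)).
  have : 0 < L / (2 * k%:R) by rewrite divr_gt0 // mulr_gt0.
  by lra.
exists k, m, (x - m *+ k); split; first by rewrite addrC subrK.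
  have : `|y x / k%:R| < L / 2.
    rewrite normrM normfV (gtr0_norm k0R) ltr_pdivrMr //.
    by move: kP; rewrite ltr_pdivrMr //; lra.
  have : L / (2 * k%:R) <= L / 2.
    rewrite ler_pM2l // lef_pV2 ?posrE ?mulr_gt0 //.
    by rewrite ler_peMr.
  by rewrite !ltr_norml => A /andP[B B']; apply/andP; split; lra.
rewrite raddfB raddfMn /= -mulr_natr.
have -> : y x - y m * k%:R = k%:R * (y x / k%:R - y m) by field; rewrite gt_eqF.
rewrite normrM (gtr0_norm k0R) -ltr_pdivlMl //.
have -> : k%:R^-1 * L = 2 * (L / (2 * k%:R)) by field; rewrite gt_eqF.
have : 0 < L / (2 * k%:R) by rewrite divr_gt0 // mulr_gt0.
by rewrite ltr_norml; lra.
Qed.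

End Density.

(** The coordinates of [(s0, y0)] in the basis [(s1, y1)], [(s2, y2)] are
    rounded to integers. *)
Lemma round_to_lattice (R : realType) (s1 y1 s2 y2 s0 y0 : R) :
  s1 * y2 - s2 * y1 != 0 ->
  exists k1 k2 : int,
    `|k1%:~R * s1 + k2%:~R * s2 - s0| <= `|s1| + `|s2| /\
    `|k1%:~R * y1 + k2%:~R * y2 - y0| <= `|y1| + `|y2|.
Proof.
set D := s1 * y2 - s2 * y1 => D0.
pose t1 := (s0 * y2 - s2 * y0) / D; pose t2 := (s1 * y0 - s0 * y1) / D.
have E1 : s0 = t1 * s1 + t2 * s2 by rewrite /t1 /t2 /D; field.
have E2 : y0 = t1 * y1 + t2 * y2 by rewrite /t1 /t2 /D; field.
exists (Num.floor t1), (Num.floor t2).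
have fl t : `|(Num.floor t)%:~R - t| <= 1 :> R.
  by have := floor_bounds t; rewrite ler_norml; lra.
suff main u1 u2 u0 : u0 = t1 * u1 + t2 * u2 ->
    `|(Num.floor t1)%:~R * u1 + (Num.floor t2)%:~R * u2 - u0| <= `|u1| + `|u2|.
  by split; exact: main.
move=> ->; rewrite (_ : _ - _ = ((Num.floor t1)%:~R - t1) * u1
  + ((Num.floor t2)%:~R - t2) * u2); last by ring.
rewrite (le_trans (ler_normD _ _)) // !normrM.
by apply: lerD; rewrite ler_piMl.
Qed.

(** * Labelled tilings and supertiles *)

Section LabelledTilings.
Variables (R : realType) (P : protoset R).
Implicit Types (T F : set (ltile P)) (A : set R) (p q : ltile P).

Lemma min_len : exists2 e : R, 0 < e & forall l : label P, e <= len l.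
Proof.
exists (\big[Num.min/1]_(l : label P) len l).
  by elim/big_ind: _ => // [x y x0 y0|l _]; [rewrite lt_min x0|exact: len_gt0].
by move=> l; rewrite (bigD1 l) //= ge_min lexx.
Qed.

Lemma len_end p : left_end p < right_end p.
Proof. by rewrite /left_end /right_end ltrDl len_gt0. Qed.

Lemma tile_unique T A p q (r : R) : tiles_exactly T A -> T p -> T q ->
  left_end p <= r < right_end p -> left_end q <= r < right_end q -> p = q.
Proof.
move=> [_ disj] Tp Tq /andP[pr rp] /andP[qr rq]; apply: contrapT => npq.
pose r' := (r + Num.min (right_end p) (right_end q)) / 2.
have [r1 r2 r3] : [/\ r < r', r' < right_end p & r' < right_end q].
  rewrite /r'; case: (lerP (right_end p) (right_end q)) => h.
    by split; lra.
  by split; lra.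
suff : (set0 : set R) r' by [].
by rewrite -(disj p q) //; split; rewrite /= in_itv /=; apply/andP; split; lra.
Qed.

(** A point of the covered region that is not its right end has a tile which
    does not merely end there: the tiles that start just to the right of the
    point cannot all be shorter than the shortest prototile. *)
Lemma half_open_cover T A (r d : R) : tiles_exactly T A -> 0 < d ->
  (forall t, r <= t <= r + d -> A t) ->
  exists2 p, T p & left_end p <= r < right_end p.
Proof.
move=> TA d0 Ar; have [e e0 eP] := min_len.
have cov t : r <= t <= r + d -> exists2 p, T p & left_end p <= t <= right_end p.
  move=> /Ar; case: TA => <- _ [p Tp]; rewrite /= in_itv /= => pt.
  by exists p.
pose t := r + Num.min d e / 2.
have [m0 md me] : [/\ 0 < Num.min d e, Num.min d e <= d & Num.min d e <= e].
  by rewrite lt_min d0 e0 !ge_min !lexx orbT.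
have [|p Tp /andP[pt tp]] := cov t; first by rewrite /t; apply/andP; split; lra.
case: (lerP (left_end p) r) => pr.
  by exists p => //; rewrite pr /= (lt_le_trans _ tp) // /t; lra.
have [|q Tq /andP[qt tq]] := cov ((r + left_end p) / 2).
  by rewrite /t in pt; apply/andP; split; lra.
case: (lerP (left_end q) r) => qr; first by exists q => //; apply/andP; split; lra.
have pq : p = q.
  apply: (tile_unique (r := left_end p) TA) => //; first by rewrite lexx len_end.
  apply/andP; split; first by lra.
  have := eP q.2; rewrite /left_end /right_end /t in pr qr pt tp tq qt *; lra.
by rewrite -pq in qt; lra.
Qed.

Lemma tiling_cover T (r : R) : tiling T ->
  exists2 p, T p & left_end p <= r < right_end p.
Proof. by move=> TT; apply: (half_open_cover TT ltr01). Qed.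

(** The half-open tiles partition the line, so the end of a tile is the start of
    the tile that contains it. *)
Lemma vertices_left_end T : tiling T -> vertices T = @left_end R P @` T.
Proof.
move=> TT; apply/seteqP; split => [x|x Tx]; last by left.
case=> // -[p Tp <-].
have [q Tq /andP[qp pq]] := tiling_cover (right_end p) TT.
exists q => //; apply/eqP; rewrite eq_le qp /= leNgt; apply/negP => lt.
have pl := len_end p.
pose r := Num.max (left_end p) (left_end q).
have [rp rq rr] : [/\ left_end p <= r, left_end q <= r & r < right_end p].
  by rewrite /r !le_max !lexx orbT gt_max pl lt.
have := tile_unique (r := r) TT Tp Tq; rewrite rp rq rr /= (lt_trans rr pq).
by move=> /(_ isT isT) E; rewrite E ltxx in pq.
Qed.

Lemma translateP t T p : translate t T p <-> T (p.1 - t, p.2).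
Proof.
split => [[q Tq <-] /=|Tp]; first by rewrite addrK -surjective_pairing.
by exists (p.1 - t, p.2); rewrite //= subrK -surjective_pairing.
Qed.

Lemma translate_set1 t p : translate t [set p] = [set (p.1 + t, p.2)].
Proof. exact: image_set1. Qed.

Lemma translate_sub t T T' : T `<=` T' -> translate t T `<=` translate t T'.
Proof. exact: image_subset. Qed.

Variable sigma : substitution_rule P.
Let lam := Defs.factor sigma.

Lemma factor_gt0 : 0 < lam.
Proof. by rewrite (lt_trans ltr01) // factor_gt1. Qed.

Lemma substitute_translate t T :
  substitute sigma (translate t T) = translate (lam * t) (substitute sigma T).
Proof.
apply/seteqP; split => [q [_ [p Tp <-]]|q].
  move=> /= qp; apply/translateP; exists p => //; move: qp.
  by rewrite !translateP /= mulrDr opprD addrA addrAC.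
move/translateP => [p Tp /translateP/= qp].
exists (p.1 + t, p.2); first by exists p.
by rewrite translateP /= mulrDr opprD addrA addrAC.
Qed.

Lemma iter_substitute_translate n t T :
  iter n (substitute sigma) (translate t T)
  = translate (lam ^+ n * t) (iter n (substitute sigma) T).
Proof.
elim: n => [|n IH] /=; first by rewrite expr0 mul1r.
by rewrite IH substitute_translate exprS mulrA.
Qed.

Lemma iter_substitute_sub n T T' : T `<=` T' ->
  iter n (substitute sigma) T `<=` iter n (substitute sigma) T'.
Proof.
move=> TT'; elim: n => //= n IH; exact: bigcup_subset.
Qed.

Lemma iter_substitute_move n (x x' : R) l q :
  iter n (substitute sigma) [set (x, l)] q ->
  iter n (substitute sigma) [set (x', l)] (q.1 + lam ^+ n * (x' - x), q.2).
Proof.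
move=> Hq; have -> : [set (x', l)] = translate (x' - x) [set (x, l)].
  by rewrite translate_set1 /= [x + _]addrC subrK.
by rewrite iter_substitute_translate; exists q.
Qed.

Lemma supertile_within n p q : iter n (substitute sigma) [set p] q ->
  lam ^+ n * left_end p <= left_end q.
Proof.
elim: n q => [q -> /=|n IH q /=]; first by rewrite expr0 mul1r.
move=> [q' /IH q'p] /translateP/= qq'.
have [E _] := replacement_exact sigma q'.2.
have : (\bigcup_(p0 in replacement sigma q'.2)
  `[left_end p0, right_end p0]%classic) (q.1 - lam * q'.1).
  exists (q.1 - lam * q'.1, q.2) => //.
  rewrite /= in_itv; apply/andP; split; first exact: lexx.
  exact: ltW (len_end (_, q.2)).
rewrite E /= in_itv /= => /andP[+ _]; rewrite subr_ge0; apply: le_trans.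
by rewrite exprS -mulrA ler_pM2l // factor_gt0.
Qed.

(** The half-open cover of every inflated tile by its replacement passes from one
    level of inflation to the next. In particular some tile of the supertile
    starts where the supertile starts. *)
Lemma supertile_cover n p (r : R) :
  lam ^+ n * left_end p <= r < lam ^+ n * right_end p ->
  exists2 q, iter n (substitute sigma) [set p] q & left_end q <= r < right_end q.
Proof.
elim: n r => [|n IH] r; first by rewrite expr0 !mul1r => ?; exists p.
have l0 := factor_gt0; rewrite exprS -!mulrA => rP.
have [|q' Hq' /andP[q'r rq']] := IH (r / lam).
  by rewrite ler_pdivlMr // ltr_pdivrMr // ![_ * lam]mulrC.
rewrite ler_pdivlMr // in q'r; rewrite ltr_pdivrMr // in rq'.
have [||q Hq /andP[qr rq]] :=
    half_open_cover (r := r - lam * q'.1) (d := right_end q' * lam - r)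
      (replacement_exact sigma q'.2); first by rewrite subr_gt0.
  move=> t /andP[t1 t2]; rewrite /= in_itv /=; apply/andP.
  by rewrite /left_end /right_end -/lam in q'r t2 *; split; lra.
exists (q.1 + lam * q'.1, q.2).
  by exists q' => //; apply/translateP; rewrite /= addrK -surjective_pairing.
by rewrite /left_end /right_end /= in qr rq *; apply/andP; split; lra.
Qed.

(** A finite patch of [T] recurs in a preimage of [T] under [n] substitutions, and
    its supertiles are then tiles of [T]. *)
Lemma inflate_patch n T F : substitution_tiling sigma T -> finite_set F ->
  F `<=` T -> exists t, translate t (iter n (substitute sigma) F) `<=` T.
Proof.
move=> /(_ n)[T' [_ [TT' _] T'T]] finF FT; rewrite -T'T.
have [t tF] := TT' F finF FT.
exists (lam ^+ n * t); rewrite -iter_substitute_translate.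
exact: iter_substitute_sub.
Qed.

End LabelledTilings.

(** * Hyperbolic pairs of forms *)

Lemma seq_argmin (R : realType) (T : eqType) (f : T -> R) (Q : pred T)
    (F : seq T) : has Q F ->
  exists2 x, Q x & forall x', x' \in F -> Q x' -> f x <= f x'.
Proof.
elim: F => //= t F IH /orP QF.
case: (boolP (has Q F)) => [/IH[x Qx xF]|nF]; last first.
  have Qt : Q t by case: QF => // h; rewrite h in nF.
  exists t => // x'; rewrite inE => /orP[/eqP-> //|x'F Qx'].
  by case/hasP: nF; exists x'.
case: (boolP (Q t && (f t <= f x))) => [/andP[Qt tx]|nt].
  exists t => // x'; rewrite inE => /orP[/eqP-> //|x'F Qx'].
  exact: le_trans (xF _ _ _).
exists x => // x'; rewrite inE => /orP[/eqP-> Qt|]; last exact: xF.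
by move: nt; rewrite Qt /= -ltNge => /ltW.
Qed.

Lemma seq_gap (R : realType) (F : seq R) :
  exists2 d : R, 0 < d & forall r, r \in F -> 0 < r -> d <= r.
Proof.
elim: F => [|t F [d d0 dF]]; first by exists 1.
exists (if 0 < t then Num.min t d else d).
  by case: ifP => // t0; rewrite lt_min t0.
move=> r; rewrite inE => /orP[/eqP-> t0|rF r0].
  by rewrite t0 ge_min lexx.
by case: ifP => _; rewrite ?ge_min dF ?orbT.
Qed.

Section HyperbolicForms.
Variables (R : realType) (s y : {additive lattice -> R}).
Hypothesis sy_det : form_det s y != 0.

Lemma lattice_argmin (f : lattice -> R) (Q : pred lattice) (B : R) x0 :
  Q x0 -> (forall x, Q x -> `|s x| <= B /\ `|y x| <= B) ->
  exists2 x, Q x & forall x', Q x' -> f x <= f x'.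
Proof.
move=> Qx0 QB; have [F FP] := finite_box sy_det B.
have QF x : Q x -> x \in F by move=> /QB[? ?]; exact: FP.
have [|x Qx xm] := seq_argmin f (Q := Q) (F := F).
  by apply/hasP; exists x0; rewrite ?QF.
by exists x => // x' Qx'; apply: xm => //; exact: QF.
Qed.

Hypothesis s_inj : forall x, s x = 0 -> x = 0.
Hypothesis y_inj : forall x, y x = 0 -> x = 0.
Variables (lam mu : R) (M : lattice -> lattice).
Hypothesis sM : forall x, s (M x) = lam * s x.
Hypothesis yM : forall x, y (M x) = mu * y x.

(** A short vector and its image under [M] form a basis of a sublattice of
    the same thinness. *)
Lemma strip_hit (e : R) : lam != mu -> `|mu| <= 1 -> 0 < e ->
  exists rho : R, forall s0 y0, exists x, `|s x - s0| <= rho /\ `|y x - y0| <= e.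
Proof.
move=> lm mu1 e0; have [|g /andP[g0 ge]] := small_value y_inj (e := e / 2).
  by rewrite divr_gt0.
exists (`|s g| + `|s (M g)|) => s0 y0.
have [|k1 [k2 [ks ky]]] := @round_to_lattice R (s g) (y g) (s (M g)) (y (M g)) s0 y0.
  rewrite sM yM (_ : _ - _ = (mu - lam) * (s g * y g)); last by ring.
  apply: mulf_neq0; first by rewrite subr_eq0 eq_sym.
  apply: mulf_neq0; last by rewrite gt_eqF.
  by apply/eqP => /s_inj g00; rewrite g00 raddf0 ltxx in g0.
exists (g *~ k1 + M g *~ k2); rewrite !raddfD !raddfMz.
move: ks ky; rewrite !mulrzl => ks ky; split => //.
apply: le_trans ky _; rewrite yM normrM (gtr0_norm g0).
have : `|mu| * y g <= y g by rewrite ler_piMl // ltW.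
by lra.
Qed.

End HyperbolicForms.

(** * The substitution defined by a hyperbolic automorphism *)

(** The tilings with vertices [s x] for [0 <= w + y x < L], where [w] varies, are
    treated together; the height of the vertex [s x] is [w + y x], measured from
    the lower end of the window. *)
Section WindowCoding.
Variables (R : realType) (s y : {additive lattice -> R}).
Hypothesis sy_det : form_det s y != 0.
Hypothesis s_inj : forall x, s x = 0 -> x = 0.
Hypothesis y_inj : forall x, y x = 0 -> x = 0.
Variables (lam mu : R) (M N : lattice -> lattice).
Hypothesis lam_gt1 : 1 < lam.
Hypothesis mu_itv : 0 < mu < 1.
Hypothesis sM : forall x, s (M x) = lam * s x.
Hypothesis yM : forall x, y (M x) = mu * y x.
Hypothesis MN : forall x, M (N x) = x.
Variables (L : R) (kap : nat) (p0 : lattice).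
Hypothesis L_gt0 : 0 < L.
Hypothesis kap_gt0 : (0 < kap)%N.
Hypothesis kapL : kap%:R * L = y p0.
Variable rho : R.
Hypothesis hit : forall s0 y0,
  exists x, `|s x - s0| <= rho /\ `|y x - y0| <= L / 4.

Definition in_window (u : R) := 0 <= u < L.

Lemma rho_ge0 : 0 <= rho.
Proof. by have [x [/(le_trans (normr_ge0 _))]] := hit 0 0. Qed.

Let kap0 : 0 < kap%:R :> R. Proof. by rewrite ltr0n. Qed.

Lemma hit_window (u s0 : R) :
  exists2 x, in_window (u + y x) & `|s x - s0| <= rho.
Proof.
have [x [sx yx]] := hit s0 (L / 2 - u); exists x => //.
by move: yx; rewrite ler_norml /in_window; have := L_gt0; lra.
Qed.

(** A step of length at least 1 is found within [rho] of [rho + 1]. *)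
Definition max_step := 2 * rho + 1.

(** Here [u] is the height of a vertex and [m] the step to the vertex that
    follows it. *)
Definition is_next (u : R) (m : lattice) := [/\ in_window (u + y m), 0 < s m,
  s m <= max_step & forall m', in_window (u + y m') -> 0 < s m' -> s m <= s m'].

Lemma is_next_exists u : exists m, is_next u m.
Proof.
have r0 := rho_ge0.
pose Q m := [&& in_window (u + y m), 0 < s m & s m <= max_step].
have [x0 wx0 sx0] := hit_window u (rho + 1).
have Qx0 : Q x0.
  by rewrite /Q wx0 /=; move: sx0; rewrite ler_norml /max_step => ?; lra.
have [x|m Qm mm] := lattice_argmin sy_det s (Q := Q) (B := max_step + `|u| + L) Qx0.
  case/and3P; rewrite /in_window => wx ? sx.
  have := ler_norm u; have := ler_norm (- u); rewrite normrN => *.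
  rewrite !ler_norml /max_step in sx *; have := L_gt0.
  by move=> ?; split; lra.
case/and3P: Qm => *; exists m; split => // m' wm' m'0.
case: (lerP (s m') max_step) => sm'; first by apply: mm; rewrite /Q wm' m'0.
by rewrite (le_trans _ (ltW sm')).
Qed.

Definition next_step u : lattice := xget 0 [set m | is_next u m].

Lemma next_stepP u : is_next u (next_step u).
Proof. by case: (is_next_exists u) => m um; exact: (xgetI 0 um). Qed.

Lemma next_step_vertex w m : in_window (w + y (m + next_step (w + y m))).
Proof. by case: (next_stepP (w + y m)) => + _ _ _; rewrite raddfD addrA. Qed.

Lemma next_step_sep w m m' : in_window (w + y m') -> s m < s m' ->
  s m + s (next_step (w + y m)) <= s m'.
Proof.
move=> wm' mm'; case: (next_stepP (w + y m)) => _ _ _ /(_ (m' - m)).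
rewrite !raddfB -addrA [y m + _]addrC subrK => /(_ wm').
by rewrite subr_gt0 => /(_ mm'); lra.
Qed.

(** The last vertex before [r]; taking it strictly before [r] serves both the
    half-open cover and the right end of a patch. *)
Lemma vertex_below w (r : R) :
  exists2 m, in_window (w + y m) & s m < r <= s m + s (next_step (w + y m)).
Proof.
have r0 := rho_ge0.
pose Q m := [&& in_window (w + y m), s m < r & r - max_step <= s m].
have [x0 wx0 sx0] := hit_window w (r - rho - 1 / 2).
have Qx0 : Q x0.
  by rewrite /Q wx0 /=; move: sx0; rewrite ler_norml /max_step => ?; lra.
have [x|m Qm mm] := lattice_argmin sy_det (fun m => - s m) (Q := Q)
    (B := max_step + `|r| + `|w| + L) Qx0.
  case/and3P; rewrite /in_window => wx ? sx.
  have := ler_norm w; have := ler_norm (- w); rewrite normrN => *.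
  have := ler_norm r; have := ler_norm (- r); rewrite normrN => *.
  rewrite !ler_norml /max_step in sx *; have := L_gt0.
  by move=> ?; split; lra.
case/and3P: Qm => wm mr rm; exists m => //; rewrite mr /= leNgt; apply/negP => h.
have [_ m0 _ _] := next_stepP (w + y m).
have /mm : Q (m + next_step (w + y m)).
  by rewrite /Q next_step_vertex raddfD /= h /=; lra.
by rewrite raddfD; lra.
Qed.

Lemma vertex_at w (r : R) :
  exists2 m, in_window (w + y m) & s m <= r < s m + s (next_step (w + y m)).
Proof.
have [m wm /andP[mr rm]] := vertex_below w r.
case: (ltrP r (s m + s (next_step (w + y m)))) => h.
  by exists m => //; rewrite (ltW mr).
exists (m + next_step (w + y m)); first exact: next_step_vertex.
have [_ n0 _ _] := next_stepP (w + y (m + next_step (w + y m))).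
by rewrite [s (_ + _)]raddfD /=; apply/andP; split; lra.
Qed.

(** The summand with denominator [lam - 1] makes up for the displacement of a
    comparison point along an inflated tile before it is pulled back by [M]. *)
Definition radius := kap%:R * max_step * lam / (lam - 1) + kap%:R * max_step + `|s p0|.

Lemma max_step_ge0 : 0 <= max_step.
Proof. by have := rho_ge0; rewrite /max_step; lra. Qed.

Lemma kap_step_ge0 : 0 <= kap%:R * max_step.
Proof. by rewrite mulr_ge0 ?max_step_ge0 // ltW. Qed.

Lemma radius_step m : `|s m| <= max_step -> kap%:R * `|s m| + `|s p0| <= radius.
Proof.
move=> sm; have : kap%:R * `|s m| <= kap%:R * max_step by rewrite ler_pM2l.
have : 0 <= kap%:R * max_step * lam / (lam - 1).
  by rewrite divr_ge0 ?mulr_ge0 ?kap_step_ge0 ?max_step_ge0 //; have := lam_gt1; lra.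
by rewrite /radius; lra.
Qed.

Lemma radius_pull m : `|s m| <= lam * max_step ->
  kap%:R * `|s m| + radius <= lam * radius.
Proof.
move=> sm; have l1 := lam_gt1.
have A : kap%:R * `|s m| <= kap%:R * max_step * lam.
  by rewrite -mulrA ler_pM2l // mulrC.
have : (lam - 1) * radius = kap%:R * max_step * lam
    + (lam - 1) * (kap%:R * max_step + `|s p0|).
  by rewrite /radius; field; rewrite subr_eq0 gt_eqF.
have : 0 <= (lam - 1) * (kap%:R * max_step + `|s p0|).
  apply: mulr_ge0; first by lra.
  by apply: addr_ge0 => //; exact: kap_step_ge0.
by lra.
Qed.

Lemma radius_ge0 : 0 <= radius.
Proof.
have := @radius_step 0; rewrite raddf0 normr0 max_step_ge0 => /(_ isT).
by rewrite mulr0 add0r; apply: le_trans.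
Qed.

(** Comparing multiples by [kap] makes the upper end [L] of the window one of the
    comparison points, since [kap * L = y p0]. *)
Definition agree (u u' : R) :=
  forall p, `|s p| <= radius -> (y p <= kap%:R * u) = (y p <= kap%:R * u').

Lemma agree_sym u u' : agree u u' -> agree u' u.
Proof. by move=> uu' p /uu'. Qed.

Lemma agree_window u u' : agree u u' -> in_window u = in_window u'.
Proof.
move=> uu'; rewrite /in_window.
have := uu' 0; rewrite !raddf0 normr0 => /(_ radius_ge0).
have := uu' p0; have := @radius_step 0.
rewrite raddf0 normr0 mulr0 add0r max_step_ge0 => /(_ isT) sp /(_ sp).
rewrite -kapL !ler_pM2l // !pmulr_rge0 // => A ->.
by rewrite !ltNge A.
Qed.

Lemma agree_shift u u' m : agree u u' -> `|s m| <= max_step ->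
  in_window (u + y m) = in_window (u' + y m).
Proof.
move=> uu' sm; rewrite /in_window.
have H v p : (y p <= kap%:R * (v + y m)) = (y (p - m *+ kap) <= kap%:R * v).
  by rewrite raddfB raddfMn /= mulrDr (mulr_natl (y m)) lerBlDr.
have sH p : `|s p| <= `|s p0| -> `|s (p - m *+ kap)| <= radius.
  move=> sp; rewrite raddfB raddfMn /= -(mulr_natl (s m)).
  rewrite (le_trans (ler_normB _ _)) // normrM (gtr0_norm kap0) addrC.
  by have := radius_step sm; lra.
have := uu' (0 - m *+ kap) (sH _ _); rewrite raddf0 normr0 => /(_ (normr_ge0 _)).
have := uu' (p0 - m *+ kap) (sH _ (lexx _)).
rewrite -!H raddf0 -kapL !ler_pM2l // !pmulr_rge0 // => A ->.
by rewrite !ltNge A.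
Qed.

Lemma agree_next u u' : agree u u' -> s (next_step u) = s (next_step u').
Proof.
have step v : `|s (next_step v)| <= max_step.
  by have [_ /gtr0_norm-> ? _] := next_stepP v.
suff H v v' : agree v v' -> s (next_step v) <= s (next_step v').
  by move=> uu'; apply/eqP; rewrite eq_le !H //; exact: agree_sym.
move=> vv'; case: (next_stepP v) => _ _ _; apply; last by case: (next_stepP v').
by rewrite (agree_shift vv') //; case: (next_stepP v').
Qed.

(** Pulling a comparison point back by [M] divides its [s]-coordinate by [lam],
    which leaves it within [radius]. *)
Lemma agree_inflate u u' m : agree u u' -> `|s m| <= lam * max_step ->
  agree (mu * u + y m) (mu * u' + y m).
Proof.
move=> uu' sm p sp.
have [mu0 _] := andP mu_itv.
have H v : (y p <= kap%:R * (mu * v + y m)) = (y (N (p - m *+ kap)) <= kap%:R * v).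
  rewrite -[RHS](ler_pM2l mu0) -yM MN raddfB raddfMn /= lerBlDr -(mulr_natl (y m)).
  by rewrite mulrDr mulrCA.
rewrite !H; apply: uu'; have l0 : 0 < lam by rewrite (lt_trans ltr01).
rewrite -(ler_pM2l l0) -[X in X * `|_|](gtr0_norm l0) -normrM -sM MN.
rewrite raddfB raddfMn /= -(mulr_natl (s m)) (le_trans (ler_normB _ _)) //.
rewrite normrM (gtr0_norm kap0); have := radius_pull sm; lra.
Qed.

(** Heights in the window lie on a known side of [y p / kap] when
    [`|y p| > kap * L]. *)
Definition comparison_points : seq lattice :=
  sval (cid (finite_box sy_det (radius + kap%:R * L))).

Lemma comparison_pointsP x : `|s x| <= radius -> `|y x| <= kap%:R * L ->
  x \in comparison_points.
Proof.
have kL : 0 <= kap%:R * L by rewrite ltW // mulr_gt0.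
have r0 := radius_ge0.
move=> sx yx; rewrite /comparison_points; case: cid => F /= FP; apply: FP; lra.
Qed.

Definition window_code (u : R) : {ffun 'I_(size comparison_points) -> bool} :=
  [ffun i : 'I_(size comparison_points) =>
     (`|s (nth 0 comparison_points i)| <= radius)
     && (y (nth 0 comparison_points i) <= kap%:R * u)].

Lemma window_codeP u u' : in_window u -> in_window u' ->
  window_code u = window_code u' <-> agree u u'.
Proof.
move=> wu wu'; split => [cuu' p sp|uu']; last first.
  apply/ffunP => i; rewrite !ffunE.
  by case: (boolP (`|s _| <= radius)) => // /uu' ->.
case: (lerP (`|y p|) (kap%:R * L)) => yp.
  have pb := comparison_pointsP sp yp.
  have pi : (index p comparison_points < size comparison_points)%N by rewrite index_mem.
  have /ffunP/(_ (Ordinal pi)) := cuu'.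
  by rewrite !ffunE /= nth_index // sp.
have B v : in_window v -> 0 <= kap%:R * v <= kap%:R * L.
  by case/andP => v0 vL; rewrite pmulr_rge0 // v0 ler_pM2l // ltW.
have := B _ wu; have := B _ wu'.
case: (lerP 0 (y p)) => y0; move: yp; [rewrite ger0_norm //|rewrite ltr0_norm //].
  by move=> *; apply/idP/idP; lra.
by move=> *; apply/idP/idP; lra.
Qed.

Lemma window0 : in_window 0.
Proof. by rewrite /in_window lexx L_gt0. Qed.

(** Only codes of points of the window are labels: other codes have no tile. *)
Definition realized (c : {ffun 'I_(size comparison_points) -> bool}) :=
  `[< exists2 u, in_window u & window_code u = c >].

Lemma window_code_realized u : in_window u -> realized (window_code u).
Proof. by move=> wu; apply/asboolP; exists u. Qed.

Definition window_label := {c | realized c}.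

Definition label_of u : window_label :=
  insubd (exist _ (window_code 0) (window_code_realized window0) : window_label)
    (window_code u).

Definition representative (l : window_label) : R :=
  xget 0 [set u | in_window u /\ window_code u = val l].

Lemma representativeP l :
  in_window (representative l) /\ window_code (representative l) = val l.
Proof.
have /asboolP[u wu cu] := valP l.
by apply: (@xgetI _ _ [set u | in_window u /\ window_code u = val l] u); split.
Qed.

Lemma representative_agree u : in_window u -> agree (representative (label_of u)) u.
Proof.
move=> wu; have [wr cr] := representativeP (label_of u); apply/window_codeP => //.
by rewrite cr /label_of insubdK //; exact: window_code_realized.
Qed.

Lemma label_agree u u' : in_window u -> in_window u' -> agree u u' ->
  label_of u = label_of u'.
Proof. by move=> wu wu' /(window_codeP wu wu') cc; rewrite /label_of cc. Qed.

Lemma step_gt0 (l : window_label) : 0 < s (next_step (representative l)).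
Proof. by case: (next_stepP (representative l)). Qed.

Definition window_protoset : protoset R := Protoset step_gt0.

Definition window_tile (w : R) (m : lattice) : ltile window_protoset :=
  (s m, label_of (w + y m)).

Definition window_tiling (w : R) : set (ltile window_protoset) :=
  [set window_tile w m | m in [set m | in_window (w + y m)]].

Lemma window_tile_right w m : in_window (w + y m) ->
  right_end (window_tile w m) = s (m + next_step (w + y m)).
Proof.
by move=> wm; rewrite /right_end /= (agree_next (representative_agree wm)) raddfD.
Qed.

Lemma window_tile_disjoint w m m' : in_window (w + y m) -> in_window (w + y m') ->
  window_tile w m <> window_tile w m' ->
  `]left_end (window_tile w m), right_end (window_tile w m)[%classic `&`
  `]left_end (window_tile w m'), right_end (window_tile w m')[%classic = set0.
Proof.
move=> wm wm' nmm'; rewrite !window_tile_right // /left_end /=.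
rewrite -subset0 => r [/=]; rewrite !in_itv /= !raddfD /=.
move=> /andP[mr rm] /andP[m'r rm'].
case: (ltgtP (s m) (s m')) => [lt|lt|eq].
- by have := next_step_sep wm' lt; lra.
- by have := next_step_sep wm lt; lra.
- apply: nmm'; congr window_tile; apply/eqP; rewrite -subr_eq0; apply/eqP.
  by apply: s_inj; rewrite raddfB eq subrr.
Qed.

Lemma window_tilingP w : tiling (window_tiling w).
Proof.
split; last first.
  move=> _ _ [m wm <-] [m' wm' <-]; exact: window_tile_disjoint.
apply/seteqP; split => // r _.
have [m wm /andP[mr rm]] := vertex_at w r.
exists (window_tile w m); first by exists m.
rewrite /= in_itv /= window_tile_right // raddfD /left_end /= mr /=; exact: ltW.
Qed.

Lemma vertices_window_tiling w :
  vertices (window_tiling w) = [set s m | m in [set m | in_window (w + y m)]].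
Proof.
rewrite vertices_left_end; last exact: window_tilingP.
apply/seteqP; split => [_ [_ [m wm <-] <-]|_ [m wm <-]]; first by exists m.
by exists (window_tile w m) => //; exists m.
Qed.

Definition window_patch (u : R) (D : R) : set (ltile window_protoset) :=
  [set window_tile u m | m in [set m | in_window (u + y m) /\ 0 <= s m < D]].

Lemma window_patch_exact u e : in_window u -> in_window (u + y e) -> 0 < s e ->
  tiles_exactly (window_patch u (s e)) `[0, s e]%classic.
Proof.
move=> wu we se0; split; last first.
  by move=> _ _ [m [wm _] <-] [m' [wm' _] <-]; exact: window_tile_disjoint.
apply/seteqP; split => [r [_ [m [wm /andP[m0 me]] <-]]|r].
  rewrite /= !in_itv /= window_tile_right // raddfD /left_end /=.
  by have := next_step_sep we me; lra.
rewrite /= in_itv /= => /andP[r0 re].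
have wz : in_window (u + y 0) by rewrite raddf0 addr0.
have Hm m : in_window (u + y m) -> s m <= r <= s m + s (next_step (u + y m)) ->
    s m < s e -> 0 < s m + s (next_step (u + y m)) ->
    (\bigcup_(p in window_patch u (s e)) `[left_end p, right_end p]%classic) r.
  move=> wm mr me m0; exists (window_tile u m).
    exists m => //; split => //; rewrite me andbT leNgt; apply/negP => lt.
    by have := @next_step_sep u m 0 wz; rewrite raddf0 => /(_ lt); lra.
  by rewrite /= in_itv /= window_tile_right // raddfD.
case: (ltrP r (s e)) => lre.
  have [m wm /andP[mr rm]] := vertex_at u r.
  by apply: (Hm m); rewrite ?mr ?(ltW rm) //; lra.
have [m wm /andP[mr rm]] := vertex_below u r.
by apply: (Hm m); rewrite ?(ltW mr) ?rm //; lra.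
Qed.

Lemma window_patch_finite u D : in_window u -> finite_set (window_patch u D).
Proof.
move=> wu; have [F FP] := finite_box sy_det (`|D| + L).
apply: (@sub_finite_set _ _ [set` [seq window_tile u m | m <- F]]).
  move=> _ [m [wm /andP[m0 mD]] <-] /=; apply: map_f; apply: FP.
    by rewrite ger0_norm //; have := ler_norm D; have := L_gt0; lra.
  have D0 : 0 <= `|D| by [].
  by rewrite ler_norml; move: wu wm; rewrite /in_window; lra.
exact: finite_seq.
Qed.

Definition inflate_label (l : label window_protoset) :=
  window_patch (mu * representative l) (lam * len l).

Lemma window_mu u : in_window u -> in_window (mu * u).
Proof.
have [mu0 mu1] := andP mu_itv => /andP[u0 uL].
have : mu * u <= u by rewrite ler_piMl // ltW.
have : 0 <= mu * u by rewrite mulr_ge0 // ltW.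
by rewrite /in_window; lra.
Qed.

Lemma inflate_label_finite l : finite_set (inflate_label l).
Proof. by apply: window_patch_finite; apply: window_mu; case: (representativeP l). Qed.

Lemma inflate_label_exact l :
  tiles_exactly (inflate_label l) `[0, lam * len l]%classic.
Proof.
have [wr _] := representativeP l; have [wn n0 _ _] := next_stepP (representative l).
rewrite /inflate_label -sM; apply: window_patch_exact; first exact: window_mu.
  by rewrite yM -mulrDr; exact: window_mu.
by rewrite sM mulr_gt0 // (lt_trans ltr01).
Qed.

Definition window_substitution : substitution_rule window_protoset :=
  SubstitutionRule lam_gt1 inflate_label_finite inflate_label_exact.

(** By [agree_inflate], replacements do not depend on the choice of the
    representatives. *)
Lemma inflate_labelE u : in_window u ->
  inflate_label (label_of u) = window_patch (mu * u) (lam * s (next_step u)).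
Proof.
move=> wu; have ru := representative_agree wu; have [wr _] := representativeP (label_of u).
have lam0 : 0 < lam by rewrite (lt_trans ltr01).
have E := agree_next ru.
rewrite /inflate_label /= E.
suff H v v' : agree v v' ->
    s (next_step v) = s (next_step u) ->
    window_patch (mu * v) (lam * s (next_step u))
      `<=` window_patch (mu * v') (lam * s (next_step u)).
  by apply/seteqP; split; apply: H => //; exact: agree_sym.
move=> vv' vu _ [m [wm /andP[m0 me]] <-].
have sm : `|s m| <= lam * max_step.
  rewrite ger0_norm // (le_trans (ltW me)) // ler_pM2l // -vu.
  by case: (next_stepP v).
have A := agree_inflate vv' sm.
have wm' : in_window (mu * v' + y m) by rewrite -(agree_window A).
exists m; first by split => //; rewrite m0.
by rewrite /window_tile (label_agree wm wm' A).
Qed.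

(** Since [mu * (w + y x) = mu * w + y (M x)], the inflated tiles join successive
    points [M x] of the strip for [mu * w], and the replacements insert the
    other lattice points of that strip. *)
Lemma substitute_window_tiling w :
  substitute window_substitution (window_tiling w) = window_tiling (mu * w).
Proof.
have lam0 : 0 < lam by rewrite (lt_trans ltr01).
have E x m : mu * w + y (M x + m) = mu * (w + y x) + y m.
  by rewrite raddfD yM mulrDr addrA.
apply/seteqP; split => [q [_ [x wx <-]]|_ [z wz <-]].
  rewrite /= inflate_labelE // => -[_ [m [wm _] <-] <-].
  exists (M x + m); first by rewrite /= E.
  by rewrite /window_tile E /= [s (_ + _)]raddfD sM addrC.
have [x wx /andP[xz zx]] := vertex_at w (s z / lam).
rewrite ler_pdivlMr // in xz; rewrite ltr_pdivrMr // in zx.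
have zE : z = M x + (z - M x) by rewrite addrC subrK.
exists (window_tile w x); first by exists x.
rewrite /= inflate_labelE //; exists (window_tile (mu * (w + y x)) (z - M x)).
  exists (z - M x) => //; rewrite /= -E -zE; split => //.
  by rewrite raddfB sM; apply/andP; split; lra.
by rewrite /window_tile -E -zE /= raddfB sM subrK.
Qed.

(** Codes are right-continuous step functions, because they record whether
    [y p <= kap * u] for finitely many [p]. *)
Lemma label_of_right u : in_window u -> exists2 d : R, 0 < d &
  forall e, 0 <= e < d -> in_window (u + e) /\ label_of (u + e) = label_of u.
Proof.
move=> wu; have [d d0 dP] := seq_gap [seq y p - kap%:R * u | p <- comparison_points].
have dk : 0 < d / kap%:R by rewrite divr_gt0.
exists (Num.min (L - u) (d / kap%:R)).
  by rewrite lt_min dk subr_gt0; case/andP: wu => _ ->.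
move=> e; rewrite lt_min => /and3P[e0 eL]; rewrite ltr_pdivlMr // => ed.
have we : in_window (u + e).
  by move: wu; rewrite /in_window => ?; apply/andP; split; lra.
split => //; rewrite /label_of; congr insubd.
apply/ffunP => i; rewrite !ffunE; congr (_ && _); rewrite mulrDr.
have ke : 0 <= kap%:R * e by rewrite mulr_ge0 // ltW.
apply/idP/idP => [h|]; last by lra.
rewrite leNgt; apply/negP => lt.
have := dP (y (nth 0 comparison_points i) - kap%:R * u).
rewrite subr_gt0 => /(_ _ lt) H.
have : d <= y (nth 0 comparison_points i) - kap%:R * u.
  by apply: H; apply/mapP; exists (nth 0 comparison_points i) => //; exact: mem_nth.
by rewrite [kap%:R * e]mulrC in h *; lra.
Qed.

(** A finite patch recurs at the lattice translates for which the heights move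
    slightly up. *)
Lemma window_tiling_patches w w' : patches_occur (window_tiling w) (window_tiling w').
Proof.
move=> F /finite_seqP[ts ->] tsw.
have [d d0 dP] : exists2 d : R, 0 < d & forall e, 0 <= e < d ->
    forall t, t \in ts -> exists2 m, in_window (w + e + y m) & t = window_tile (w + e) m.
  elim: ts tsw => [|t ts IH] tsw; first by exists 1.
  have [|d d0 dP] := IH; first by move=> t' t'ts; apply: tsw; rewrite /= inE t'ts orbT.
  have [|m wm mt] := tsw t; first by rewrite /= inE eqxx.
  have [d' d'0 d'P] := label_of_right wm.
  exists (Num.min d d'); first by rewrite lt_min d0.
  move=> e; rewrite lt_min => /and3P[e0 ed ed'] t'; rewrite inE => /orP[/eqP->|].
    have [|we le] := d'P e; first by rewrite e0.
    by exists m; rewrite /window_tile addrAC ?le.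
  by apply: dP; rewrite e0.
have [z /andP[z1 z2]] := dense_values y_inj (c := w - w') (d := w - w' + d) ltac:(lra).
exists (s z) => _ [t /= tts <-].
have [|m wm ->] := dP (w' - w + y z) _ t tts; first by apply/andP; split; lra.
have E : w + (w' - w + y z) + y m = w' + y (m + z) by rewrite raddfD; ring.
rewrite E in wm; exists (m + z) => //.
by rewrite /window_tile E /= [s (_ + _)]raddfD.
Qed.

Lemma window_substitution_tiling w :
  substitution_tiling window_substitution (window_tiling w).
Proof.
have [mu0 _] := andP mu_itv.
move=> n; exists (window_tiling (w / mu ^+ n)); split.
- exact: window_tilingP.
- by split; exact: window_tiling_patches.
- have -> w' : iter n (substitute window_substitution) (window_tiling w')
      = window_tiling (mu ^+ n * w').
    elim: n => [|n IH] /=; first by rewrite expr0 mul1r.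
    by rewrite IH substitute_window_tiling mulrA -exprS.
  by rewrite mulrCA mulfV ?mulr1 // expf_neq0 // gt_eqF.
Qed.

End WindowCoding.

Section AutomorphismGivesSubstitution.
Variables (R : realType) (s y : {additive lattice -> R}).
Hypothesis sy_det : form_det s y != 0.
Hypothesis y_inj : forall x, y x = 0 -> x = 0.
Variables (lam mu : R) (M N : lattice -> lattice).
Hypothesis lam_gt1 : 1 < `|lam|.
Hypothesis mu_lt1 : `|mu| < 1.
Hypothesis sM : forall x, s (M x) = lam * s x.
Hypothesis yM : forall x, y (M x) = mu * y x.
Hypothesis MN : forall x, M (N x) = x.

Lemma ux_neq0 : ux != 0.
Proof. by apply/eqP => /matrixP/(_ 0 0); rewrite !mxE. Qed.

Lemma contraction_neq0 : mu != 0.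
Proof.
apply/eqP => mu0; have := ux_neq0; rewrite -(MN ux) => /eqP; apply.
by apply: y_inj; rewrite yM mu0 mul0r.
Qed.

(** [M] would shrink the vectors of the kernel of [s], against discreteness. *)
Lemma contraction_kernel_trivial x : s x = 0 -> x = 0.
Proof.
move=> sx; apply/eqP/negPn/negP => x0.
pose Q z := [&& s z == 0, z != 0 & `|y z| <= `|y x|].
have Qx : Q x by rewrite /Q sx eqxx x0 lexx.
have [z|z /and3P[/eqP sz z0 zx] zm] :=
    lattice_argmin sy_det (fun z => `|y z|) (Q := Q) (B := `|y x|) Qx.
  by case/and3P => /eqP -> _ ->; rewrite normr0.
have yz : 0 < `|y z| by rewrite normr_gt0; apply: contra z0 => /eqP/y_inj ->.
have lt : `|y (M z)| < `|y z| by rewrite yM normrM gtr_pMl.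
have /zm : Q (M z); last by rewrite leNgt lt.
rewrite /Q sM sz mulr0 eqxx (le_trans (ltW lt) zx) andbT /=.
apply/eqP => Mz; move: lt; rewrite Mz raddf0.
have := yM z; rewrite Mz raddf0 => /esym/eqP.
rewrite mulf_eq0 (negPf contraction_neq0) /= => /eqP yz0.
by rewrite yz0 normr0 ltxx in yz.
Qed.

(** The square of [M] has positive eigenvalues, as the coding requires. *)
Theorem automorphism_substitution (a b : R) (kap : nat) (p0 : lattice) :
  a < b -> (0 < kap)%N -> kap%:R * (b - a) = y p0 ->
  admits_substitution [set s x | x in [set x | a <= y x < b]].
Proof.
move=> ab kap0 kapL.
have L0 : 0 < b - a by rewrite subr_gt0.
have s_inj := contraction_kernel_trivial.
have lam2 : 1 < lam ^+ 2 by rewrite -(ger0_norm (sqr_ge0 lam)) normrX exprn_egt1.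
have mu2 : 0 < mu ^+ 2 < 1.
  rewrite exprn_even_gt0 //= contraction_neq0 /= -(ger0_norm (sqr_ge0 mu)).
  by rewrite normrX exprn_ilt1.
pose M2 x := M (M x); pose N2 x := N (N x).
have sM2 x : s (M2 x) = lam ^+ 2 * s x by rewrite !sM mulrA.
have yM2 x : y (M2 x) = mu ^+ 2 * y x by rewrite !yM mulrA.
have MN2 x : M2 (N2 x) = x by rewrite /M2 /N2 !MN.
have [|||rho hit] := strip_hit s_inj y_inj sM2 yM2 (e := (b - a) / 4).
- by apply/eqP => E; rewrite E in lam2; have [_] := andP mu2; lra.
- by rewrite ger0_norm ?sqr_ge0 // ltW //; case/andP: mu2.
- by rewrite divr_gt0.
exists (window_protoset sy_det (lam ^+ 2) kap p0 L0 hit), (window_tiling (- a)),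
  (window_substitution sy_det s_inj lam2 mu2 sM2 yM2 L0 kap0 kapL hit).
split; first exact: (window_tilingP _ _ _ _ _ _ _ (- a)).
  rewrite vertices_window_tiling //; congr (_ @` _); apply/seteqP.
  by split => x; rewrite /= /in_window => ?; lra.
exact: (window_substitution_tiling _ _ _ _ _ _ _ MN2).
Qed.

End AutomorphismGivesSubstitution.

(** * Lifting the vertices of a substitution tiling *)

(** Bernoulli's inequality. *)
Lemma power_exceeds (R : realType) (x C : R) : 1 < x -> exists n : nat, C < x ^+ n.
Proof.
move=> x1; have [n _ nC] := natr_exceeds (C / (x - 1)).
have x10 : 0 < x - 1 by lra.
exists n; rewrite ltr_pdivrMr // in nC; apply: lt_le_trans nC _.
suff : 1 + n%:R * (x - 1) <= x ^+ n by lra.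
elim: n => [|n IH]; first by rewrite mul0r addr0 expr0.
rewrite exprS -natr1; have : x * (1 + n%:R * (x - 1)) <= x * x ^+ n.
  by rewrite ler_pM2l //; lra.
by have : 0 <= n%:R * (x - 1) ^+ 2 by [rewrite mulr_ge0 ?sqr_ge0|]; lra.
Qed.

(** With [g] the primitive vector of which [x0] is a multiple, the form is a multiple of the
    determinant with [g], which takes the value 1 by Bezout. *)
Lemma degenerate_form (R : realType) (s : {additive lattice -> R}) (x0 : lattice) :
  x0 != 0 -> s x0 = 0 -> exists (c : R) (g x1 : lattice),
    [/\ s x1 = c, (forall x, exists k : int, s x = c *~ k) &
        forall x, s x = 0 -> c != 0 -> exists k : int, x = g *~ k].
Proof.
set i := x0 0 0; set j := x0 1 0 => n0 sx0.
have d0 : gcdz i j != 0.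
  rewrite gcdz_eq0; apply: contra n0 => /andP[/eqP i0 /eqP j0].
  by rewrite (latticeE x0) -/i -/j i0 j0 !mulr0z addr0.
have /dvdzP[i' iE] := dvdz_gcdl i j; have /dvdzP[j' jE] := dvdz_gcdr i j.
have [u [v uv]] := Bezoutz i j.
move: (gcdz i j) d0 iE jE uv => d d0 iE jE uv.
have uv1 : u * i' + v * j' = 1.
  apply: (mulIf d0); rewrite mul1r -[RHS]uv iE jE; ring.
have uv1R : u%:~R * i'%:~R + v%:~R * j'%:~R = 1 :> R.
  by rewrite -!intrM -intrD uv1.
set s0 := s ux; set s1 := s uy.
have sg : s0 * i'%:~R + s1 * j'%:~R = 0.
  have dR : d%:~R != 0 :> R by rewrite intr_eq0.
  apply: (mulIf dR); rewrite mul0r -sx0 (formE s) -/s0 -/s1 -/i -/j.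
  by rewrite iE jE !intrM; ring.
pose c := u%:~R * s1 - v%:~R * s0.
pose k (x : lattice) := i' * x 1 0 - j' * x 0 0.
have sk x : s x = c * (k x)%:~R.
  rewrite (formE s) -/s0 -/s1 /c /k intrB !intrM.
  set p := (x 0 0)%:~R; set q := (x 1 0)%:~R.
  have -> : s0 * p + s1 * q = (s0 * p + s1 * q) * (u%:~R * i'%:~R + v%:~R * j'%:~R).
    by rewrite uv1R mulr1.
  apply/eqP; rewrite -subr_eq0; apply/eqP.
  rewrite [LHS](_ : _ = (s0 * i'%:~R + s1 * j'%:~R) * (u%:~R * p + v%:~R * q)).
    by rewrite sg mul0r.
  by ring.
have k_comb m n : k (ux *~ m + uy *~ n) = i' * n - j' * m.
  rewrite /k -!scaler_int !mxE /= !mulr1 !mulr0 addr0 add0r.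
  by rewrite !intz.
exists c, (ux *~ i' + uy *~ j'), (ux *~ (- v) + uy *~ u); split.
- by rewrite sk k_comb mulrN opprK mulrC [j' * v]mulrC [i' * u]mulrC uv1 mul1r.
- by move=> x; exists (k x); rewrite sk mulrzr.
- move=> x /eqP; rewrite sk mulf_eq0 => + c0; rewrite (negPf c0) /= intr_eq0.
  rewrite /k subr_eq0 => /eqP kx; exists (u * x 0 0 + v * x 1 0).
  rewrite [LHS]latticeE mulrzDl -!mulrzA; congr (_ *~ _ + _ *~ _).
    have -> : i' * (u * x 0 0 + v * x 1 0) = u * i' * x 0 0 + v * (i' * x 1 0) by ring.
    by rewrite kx -[LHS]mul1r -uv1; ring.
  have -> : j' * (u * x 0 0 + v * x 1 0) = u * (j' * x 0 0) + v * j' * x 1 0 by ring.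
  by rewrite -kx -[LHS]mul1r -uv1; ring.
Qed.

(** A lattice vector in the kernel of [y] would be a period. *)
Lemma nonperiodic_inj (R : realType) (s y : {additive lattice -> R}) (a b : R) :
  form_det s y != 0 -> nonperiodic [set s x | x in [set x | a <= y x < b]] ->
  forall x, y x = 0 -> x = 0.
Proof.
move=> D0 hnp x yx; apply: contrapT => x0.
have sx : s x != 0 by apply/eqP => sx; apply: x0; exact: (forms_eq0 D0).
apply: (hnp _ sx); apply/seteqP; split => [_ [_ [z zw <-] <-]|_ [z zw <-]].
  by exists (z + x); rewrite /= raddfD // yx addr0.
exists (s z - s x); last by rewrite subrK.
by exists (z - x); rewrite /= raddfB // yx subr0.
Qed.

Lemma vertex_net (R : realType) (y : {additive lattice -> R}) (a b e : R) :
  (forall x, y x = 0 -> x = 0) -> 0 < e -> exists xs : seq lattice, forall d,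
  a + e < d <= b -> exists x, [/\ x \in xs, a <= y x < b & d - e < y x < d].
Proof.
move=> y_inj e0.
have H (i : nat) : exists x, a + i%:R * (e / 2) < y x < a + (i%:R + 1) * (e / 2).
  by apply: (dense_values y_inj); rewrite mulrDl mul1r; lra.
have [z zP] := choice H.
have [K _ KP] := natr_exceeds ((b - a) / (e / 2)).
rewrite ltr_pdivrMr ?divr_gt0 // in KP.
exists [seq z i | i <- iota 0 K] => d /andP[ad db].
have := floor_bounds ((d - a) / (e / 2)).
set k := Num.floor _ => /andP[k1 k2].
rewrite ler_pdivlMr ?divr_gt0 // in k1; rewrite ltr_pdivrMr ?divr_gt0 // in k2.
have kgt1 : 1 < k.
  rewrite -(ltr_int R) -(ltrD2r 1) -(ltr_pM2r (x := e / 2)) ?divr_gt0 //.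
  by apply: le_lt_trans k2; rewrite mulrDl; lra.
have [i iE] : exists i : nat, k = i%:Z + 1 by exists (absz (k - 1)); lia.
have := zP i; rewrite iE intrD -[i%:~R]/(i%:R) in k1 k2 *.
rewrite !mulrDl !mul1r in k1 k2 * => /andP[z1 z2].
exists (z i); split.
- apply: map_f; rewrite mem_iota /= add0n -(ltr_nat R).
  by rewrite -(ltr_pM2r (x := e / 2)) ?divr_gt0 //; lra.
- have : 0 <= i%:R * (e / 2) by rewrite mulr_ge0 // ltW // divr_gt0.
  by move=> ?; apply/andP; split; lra.
- by apply/andP; split; lra.
Qed.

Section SubstitutionLifts.
Variables (R : realType) (s y : {additive lattice -> R}).
Hypothesis sy_det : form_det s y != 0.
Hypothesis y_inj : forall x, y x = 0 -> x = 0.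
Variables (a b : R).
Hypothesis ab : a < b.
Let vertex (x : lattice) := a <= y x < b.
Variables (P : protoset R) (T : set (ltile P)) (sigma : substitution_rule P).
Hypothesis T_tiling : tiling T.
Hypothesis T_vertices : vertices T = [set s x | x in [set x | vertex x]].
Hypothesis T_sub : substitution_tiling sigma T.
Let lam := Defs.factor sigma.

Lemma tile_start p : T p -> exists2 x, vertex x & left_end p = s x.
Proof.
move=> Tp; have : vertices T (left_end p) by left; exists p.
by rewrite T_vertices => -[x vx <-]; exists x.
Qed.

Lemma vertex_tile x : vertex x -> exists l, T (s x, l).
Proof.
move=> vx; have : vertices T (s x) by rewrite T_vertices; exists x.
rewrite (vertices_left_end T_tiling) => -[[r l] Tp <-].
by exists l.
Qed.

Lemma bounded_patch_finite (B : R) : finite_set [set p | T p /\ `|left_end p| <= B].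
Proof.
have [F FP] := finite_box sy_det (`|B| + `|a| + `|b|).
apply: (@sub_finite_set _ _
  [set` [seq ((s x, l) : (R * label P)%type) | x <- F, l <- enum (label P)]]).
  move=> [r l] [/[dup] Tp /tile_start[x vx /= rx] pB]; apply/allpairsP.
  exists (x, l); rewrite mem_enum /= -[r]/(left_end (r, l)) rx; split => //.
  have := ler_norm a; have := ler_norm (- a); have := ler_norm (- b).
  have := ler_norm b; rewrite !normrN => *; have := ler_norm B.
  rewrite rx in pB; have := normr_ge0 a; have := normr_ge0 b; have := normr_ge0 B.
  move: vx; rewrite /vertex => *.
  by apply: FP; [lra|rewrite ler_norml; lra].
exact: finite_seq.
Qed.

Lemma inflate_bounded n (B : R) : exists t, forall p, T p -> `|left_end p| <= B ->
  translate t (iter n (substitute sigma) [set p]) `<=` T.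
Proof.
have [|t tP] := inflate_patch n T_sub (bounded_patch_finite B); first by move=> p [].
exists t => p Tp pB; apply: subset_trans tP; apply: translate_sub.
by apply: iter_substitute_sub => _ ->.
Qed.

Lemma supertile_start n t p : T p ->
  translate t (iter n (substitute sigma) [set p]) `<=` T ->
  exists2 x, vertex x & s x = lam ^+ n * left_end p + t.
Proof.
move=> Tp tP; have ln : 0 < lam ^+ n by rewrite exprn_gt0 // factor_gt0.
have [|q qp /andP[q1 _]] := @supertile_cover R P sigma n p (lam ^+ n * left_end p).
  by rewrite lexx ltr_pM2l // len_end.
have E : left_end q = lam ^+ n * left_end p.
  by apply/eqP; rewrite eq_le q1 /= supertile_within.
have [|x vx sx] := @tile_start (q.1 + t, q.2); first by apply: tP; exists q.
by exists x => //; rewrite -sx -E.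
Qed.

Lemma seq_bound (xs : seq lattice) : exists B : R, forall x, x \in xs -> `|s x| <= B.
Proof.
elim: xs => [|x xs [B BP]]; first by exists 0.
exists (Num.max `|s x| B) => z; rewrite inE le_max => /orP[/eqP->|/BP ->].
  by rewrite lexx.
by rewrite orbT.
Qed.

Lemma lift_vertices n (xs : seq lattice) : exists t, forall x, x \in xs -> vertex x ->
  exists2 x', vertex x' & s x' = lam ^+ n * s x + t.
Proof.
have [B BP] := seq_bound xs; have [t tP] := inflate_bounded n B.
exists t => x xxs vx; have [l Tx] := vertex_tile vx.
by have [|x' vx' sx'] := supertile_start Tx (tP _ Tx _); [exact: BP|exists x'].
Qed.

(** Two vertices that differ by [m] exist because the values of [y] are dense, and
    their inflations are again vertices. *)
Lemma lift_difference n m : `|y m| < b - a ->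
  exists2 m', `|y m'| < b - a & s m' = lam ^+ n * s m.
Proof.
rewrite ltr_norml => /andP[m1 m2].
have [|x] := dense_values y_inj (c := Num.max a (a - y m)) (d := Num.min b (b - y m)).
  by rewrite gt_max !lt_min; apply/andP; split; apply/andP; split; lra.
rewrite gt_max lt_min => /andP[/andP[x1 x2] /andP[x3 x4]].
have [t tP] := lift_vertices n [:: x; x + m].
have vx : vertex x by rewrite /vertex; apply/andP; split; lra.
have vxm : vertex (x + m) by rewrite /vertex raddfD; apply/andP; split; lra.
have [x' vx' sx'] := tP x (mem_head _ _) vx.
have [|z' vz' sz'] := tP (x + m) _ vxm; first by rewrite !inE eqxx orbT.
exists (z' - x').
  by move: vx' vz'; rewrite raddfB ltr_norml /vertex => *; lra.
by rewrite raddfB /= sx' sz' raddfD; ring.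
Qed.

Lemma inflate_form x : exists x', s x' = lam * s x.
Proof.
have [|k [m [r [-> ym yr]]]] := small_generate y_inj (L := b - a) x.
  by rewrite subr_gt0.
have [m' _ sm'] := lift_difference 1 ym; have [r' _ sr'] := lift_difference 1 yr.
rewrite expr1 in sm' sr'.
by exists (m' *+ k + r'); rewrite !raddfD !raddfMn /= sm' sr' mulrDr mulrnAr.
Qed.


(** If [s] had a kernel, generated by [g], then [lam] would be an integer, and
    the vertices of a fine net of the window, inflated by a large power of
    [lam], would have heights that are spread densely modulo [y g], which exceeds
    the length of the window. *)
Lemma form_injective :
  nonperiodic [set s x | x in [set x | vertex x]] -> forall x, s x = 0 -> x = 0.
Proof.
move=> hnp x0 sx0; apply: contrapT => /eqP n0.
have [c [g [x1 [sx1 sc sker]]]] := degenerate_form n0 sx0.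
have c0 : c != 0.
  apply/eqP => c0; move: sy_det; rewrite /form_det.
  have [k1 ->] := sc ux; have [k2 ->] := sc uy.
  by rewrite c0 !mul0rz !mul0r subrr eqxx.
have {}sker x : s x = 0 -> exists k : int, x = g *~ k by move=> sx; exact: sker.
wlog g0 : g sker / 0 < y g.
  move=> W; case: (ltgtP 0 (y g)) => yg; first exact: (W g).
    apply: (W (- g)); last by rewrite raddfN oppr_gt0.
    by move=> x /sker[k ->]; exists (- k); rewrite mulNrz mulrNz opprK.
  have [k xk] := sker _ sx0; move: n0.
  by rewrite xk (y_inj (esym yg)) mul0rz eqxx.
have sg : s g = 0.
  have [k x0E] := sker _ sx0; move: sx0 n0; rewrite x0E raddfMz /= => /eqP.
  rewrite -mulrzr mulf_eq0 intr_eq0 => /orP[/eqP //|/eqP ->].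
  by rewrite mulr0z eqxx.
have yshift x k : y (x + g *~ k) = y x + k%:~R * y g.
  by rewrite raddfD raddfMz /= mulrzl.
have sshift x k : s (x + g *~ k) = s x.
  by rewrite raddfD raddfMz /= sg mul0rz addr0.
have Lg : b - a < y g.
  rewrite ltNge; apply/negP => gL.
  have into x : exists2 x', vertex x' & s x' = s x.
    have := floor_bounds ((y x - a) / y g); set k := Num.floor _ => /andP[k1 k2].
    rewrite ler_pdivlMr // in k1; rewrite ltr_pdivrMr // mulrDl in k2.
    exists (x + g *~ (- k)); last exact: sshift.
    by rewrite /vertex yshift mulrNz; lra.
  apply: (hnp _ c0); apply/seteqP; split => [_ [_ [z zw <-] <-]|_ [z zw <-]].
    have [z' vz' sz'] := into (z + x1); exists z' => //.
    by rewrite sz' raddfD sx1.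
  have [z' vz' sz'] := into (z - x1); exists (s z'); first by exists z'.
  by rewrite sz' raddfB sx1 subrK.
have [x1' sx1'] := inflate_form x1; have [k1 k1E] := sc x1'.
have lamE : lam = k1%:~R.
  by apply: (mulIf c0); rewrite mulrzl -k1E sx1' sx1.
have [n nP] := power_exceeds (4 * y g / (b - a)) (factor_gt1 sigma).
have ba0 : 0 < b - a by rewrite subr_gt0.
rewrite ltr_pdivrMr // -/lam in nP.
set ln := lam ^+ n in nP.
have ln0 : 0 < ln by rewrite exprn_gt0 // factor_gt0.
pose eta := y g - (b - a); have eta0 : 0 < eta by rewrite subr_gt0.
pose e := Num.min ((b - a) / 4) (eta / (2 * ln)).
have e0 : 0 < e by rewrite lt_min !divr_gt0 // mulr_gt0.
have eL : e <= (b - a) / 4 by rewrite ge_min lexx.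
have eeta : ln * e <= eta / 2.
  have -> : eta / 2 = ln * (eta / (2 * ln)) by field; rewrite gt_eqF.
  by rewrite ler_pM2l // ge_min lexx orbT.
have [xs xsP] := vertex_net a b y_inj e0.
have [t tP] := lift_vertices n xs.
have [|xb [xbs vxb _]] := xsP b; first by rewrite lexx andbT; lra.
have [xb' vxb' sxb'] := tP xb xbs vxb.
pose th := y xb' - ln * y xb.
have lift x : x \in xs -> vertex x -> exists k : int,
    a <= th + ln * y x + k%:~R * y g < b.
  move=> xxs vx; have [x' vx' sx'] := tP x xxs vx.
  have [|k kE] := sker (x' - xb' - (x - xb) *~ (k1 ^+ n)).
    rewrite raddfB raddfMz !raddfB /= sx' sxb' -(mulrzr (s x - s xb)).
    by rewrite rmorphXn /= -lamE -/ln; ring.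
  exists k; have : y x' = th + ln * y x + k%:~R * y g; last by move=> <-.
  have -> : x' = xb' + (x - xb) *~ (k1 ^+ n) + g *~ k.
    by rewrite -kE addrC -[x' - _ - _]addrA -opprD subrK.
  rewrite yshift raddfD raddfMz raddfB /= -(mulrzr (y x - y xb)) rmorphXn /= -lamE.
  by rewrite /th -/ln; ring.
have := floor_bounds ((ln * b + th - a - y g) / y g).
set j := Num.floor _ => /andP[j1 j2].
rewrite ler_pdivlMr // in j1; rewrite ltr_pdivrMr // mulrDl mul1r in j2.
pose d := (a + y g + j%:~R * y g - th) / ln.
have dln : ln * d = a + y g + j%:~R * y g - th by rewrite mulrC divfK // gt_eqF.
have [|x [xxs vx /andP[xd1 xd2]]] := xsP d.
  apply/andP; split; last by rewrite -(ler_pM2l ln0) dln; lra.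
  rewrite -(ltr_pM2l ln0) dln.
  by have : ln * e <= ln * ((b - a) / 4); [rewrite ler_pM2l|lra].
have [k kP] := lift x xxs vx.
rewrite -(ltr_pM2l ln0) dln in xd2; rewrite -(ltr_pM2l ln0) mulrBr dln in xd1.
case: (lerP 0 (j + k)) => jk.
  have : 0 <= (j + k)%:~R * y g by rewrite mulr_ge0 ?ler0z // ltW.
  by rewrite intrD /eta in eeta *; lra.
have : (j + k + 1)%:~R * y g <= 0.
  by rewrite mulr_le0_ge0 ?(ltW g0) // lerz0 lezD1.
by rewrite !intrD; lra.
Qed.

End SubstitutionLifts.

(** * The automorphism induced by a substitution *)

Lemma mulmx2E (M : 'M[int]_2) (x : lattice) i :
  (M *m x) i 0 = M i 0 * x 0 0 + M i 1 * x 1 0.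
Proof.
rewrite mxE !big_ord_recl big_ord0 addr0.
by congr (M i _ * x _ _ + M i _ * x _ _); exact: val_inj.
Qed.

Lemma det2E (R : comPzRingType) (M : 'M[R]_2) : \det M = M 0 0 * M 1 1 - M 0 1 * M 1 0.
Proof.
rewrite (expand_det_row _ 0) !big_ord_recl big_ord0 addr0 /cofactor !det_mx11 !mxE.
have -> : lift 0 0 = 1 :> 'I_2 by exact: val_inj.
have -> : lift 1 0 = 0 :> 'I_2 by exact: val_inj.
by rewrite /= expr0 expr1 mul1r mulN1r mulrN.
Qed.

Lemma tr2E (R : pzRingType) (M : 'M[R]_2) : \tr M = M 0 0 + M 1 1.
Proof.
rewrite /mxtrace !big_ord_recl big_ord0 addr0.
by congr (_ + M _ _); exact: val_inj.
Qed.

Lemma cayley_hamilton2 (M : 'M[int]_2) (x : lattice) :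
  M *m (M *m x) = (M *m x) *~ \tr M - x *~ \det M.
Proof.
apply/matrixP => i j; rewrite !(ord1 j) det2E tr2E.
have E c d (u v : lattice) : (c *: u - d *: v) i 0 = c * u i 0 - d * v i 0.
  by rewrite !mxE.
rewrite -!scaler_int E !mulmx2E !intz.
by case: (ord2E i) => ->; ring.
Qed.

Lemma columns_matrix (x1 x2 : lattice) : exists M : 'M[int]_2,
  forall x, M *m x = x1 *~ x 0 0 + x2 *~ x 1 0.
Proof.
exists (\matrix_(i, j) if j == 0 then x1 i 0 else x2 i 0) => x.
apply/matrixP => i j; rewrite !(ord1 j) mulmx2E -!scaler_int !mxE /= !intz.
by rewrite mulrC [x2 _ _ * _]mulrC.
Qed.

Lemma form_matrix (R : realType) (s : {additive lattice -> R}) (lam : R) :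
  (forall x, exists x', s x' = lam * s x) ->
  exists M : 'M[int]_2, forall x, s (M *m x) = lam * s x.
Proof.
move=> H; have [x1 x1E] := H ux; have [x2 x2E] := H uy.
have [M ME] := columns_matrix x1 x2; exists M => x.
by rewrite ME raddfD !raddfMz /= x1E x2E (formE s x) mulrDr !mulrA !mulrzr.
Qed.

Lemma form_cayley_hamilton (R : realType) (f : {additive lattice -> R})
    (M : 'M[int]_2) x :
  f (M *m (M *m x)) = (\tr M)%:~R * f (M *m x) - (\det M)%:~R * f x.
Proof. by rewrite cayley_hamilton2 raddfB !(raddfMz f) !mulrzl. Qed.

Lemma form_power (R : realType) (f : {additive lattice -> R}) (k : R)
    (M : 'M[int]_2) n x : (forall x, f (M *m x) = k * f x) ->
  f (M ^+ n *m x) = k ^+ n * f x.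
Proof.
move=> fM; elim: n => [|n IH]; first by rewrite !expr0 mul1mx mul1r.
by rewrite !exprS -mulmxA fM IH mulrA.
Qed.

Lemma integer_eigenvalue_scalar (R : realType) (f : {additive lattice -> R})
    (M : 'M[int]_2) (k : int) : (forall x, f x = 0 -> x = 0) ->
  (forall x, f (M *m x) = k%:~R * f x) -> forall x : lattice, M *m x = x *~ k.
Proof.
move=> f_inj fM x; apply/eqP; rewrite -subr_eq0; apply/eqP; apply: f_inj.
by rewrite raddfB raddfMz /= fM mulrzl subrr.
Qed.

Section Eigenforms.
Variables (R : realType) (s y : {additive lattice -> R}).
Hypothesis s_inj : forall x, s x = 0 -> x = 0.
Hypothesis y_inj : forall x, y x = 0 -> x = 0.
Variables (lam : R) (M : 'M[int]_2).
Hypothesis sM : forall x, s (M *m x) = lam * s x.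

Lemma inj_neq0 (f : {additive lattice -> R}) : (forall x, f x = 0 -> x = 0) ->
  f ux != 0.
Proof. by move=> f_inj; apply: contra ux_neq0 => /eqP/f_inj ->. Qed.

Definition conjugate_eigenvalue : R := (\tr M)%:~R - lam.

Lemma conjugate_mul : lam * conjugate_eigenvalue = (\det M)%:~R.
Proof.
apply: (mulIf (inj_neq0 s_inj)); have := sM (M *m ux).
rewrite form_cayley_hamilton !sM /conjugate_eigenvalue.
move=> E; transitivity ((\tr M)%:~R * (lam * s ux) - lam * (lam * s ux)); first by ring.
by rewrite -E; ring.
Qed.

Hypothesis lam_gt1 : 1 < lam.
Variable L : R.
Hypothesis L_gt0 : 0 < L.
Hypothesis bounded : forall n m, `|y m| < L -> `|y (M ^+ n *m m)| < L.

Let mu := conjugate_eigenvalue.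

(** The form [y \o M - mu * y] is multiplied by [lam] under [M], by
    Cayley-Hamilton, and so it can only be bounded along orbits if it is 0. *)
Lemma conjugate_form x : y (M *m x) = mu * y x.
Proof.
suff small m : `|y m| < L -> y (M *m m) = mu * y m.
  have [k [m [r [-> ym yr]]]] := small_generate y_inj x L_gt0.
  rewrite mulmxDr raddfD /= (small r) // (raddfMn (mulmx M)) !raddfMn /= small //.
  by rewrite raddfD raddfMn /= mulrDr mulrnAr.
move=> ym; apply/eqP; rewrite -subr_eq0; apply/negPn/negP => z0.
pose z x := y (M *m x) - mu * y x.
have zM u : z (M *m u) = lam * z u.
  rewrite /z form_cayley_hamilton -conjugate_mul.
  by rewrite /mu /conjugate_eigenvalue; ring.
have zMn n : z (M ^+ n *m m) = lam ^+ n * z m.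
  elim: n => [|n IH]; first by rewrite !expr0 mul1mx mul1r.
  by rewrite !exprS -mulmxA zM IH mulrA.
have MS n : M *m (M ^+ n *m m) = M ^+ n.+1 *m m by rewrite exprS -mulmxA.
have zm : 0 < `|z m| by rewrite normr_gt0.
have [n] := power_exceeds (L * (1 + `|mu|) / `|z m|) lam_gt1.
have ln0 : 0 < lam ^+ n by rewrite exprn_gt0 // (lt_trans ltr01).
rewrite ltr_pdivrMr // -(gtr0_norm ln0) -normrM -zMn /z MS.
move/lt_le_trans/(_ (ler_normB _ _)).
have := bounded n ym; have := bounded n.+1 ym; rewrite normrM => A B.
have : `|mu| * `|y (M ^+ n *m m)| <= `|mu| * L by rewrite ler_wpM2l // ltW.
by lra.
Qed.

Lemma conjugate_neq : lam != mu.
Proof.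
apply/eqP => E; have [g /andP[g0 gL]] := small_value y_inj L_gt0.
have [n nP] := power_exceeds (L / y g) lam_gt1.
have := @bounded n g; rewrite (gtr0_norm g0) => /(_ gL).
have ln0 : 0 < lam ^+ n by rewrite exprn_gt0 // (lt_trans ltr01).
rewrite (form_power _ _ conjugate_form) -E (gtr0_norm (mulr_gt0 ln0 g0)).
by rewrite ltr_pdivrMr // in nP; lra.
Qed.

Lemma not_integer_eigenvalue (N : 'M[int]_2) (l m : R) (k : int) :
  (forall x, s (N *m x) = l * s x) -> (forall x, y (N *m x) = m * y x) ->
  l != m -> (l != k%:~R) && (m != k%:~R).
Proof.
move=> sN yN lm; apply/andP; split; apply/eqP => E; move/eqP: lm; apply.
  apply: (mulIf (inj_neq0 y_inj)); rewrite -yN.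
  rewrite (integer_eigenvalue_scalar (k := k) s_inj) ?raddfMz ?E ?mulrzl //.
  by move=> x; rewrite sN E.
apply: (mulIf (inj_neq0 s_inj)); rewrite -sN.
rewrite (integer_eigenvalue_scalar (k := k) y_inj) ?raddfMz ?E ?mulrzl //.
by move=> x; rewrite yN E.
Qed.

Lemma conjugate_lt1 : `|mu| < 1.
Proof.
have le1 : `|mu| <= 1.
  rewrite leNgt; apply/negP => mu1.
  have [g /andP[g0 gL]] := small_value y_inj L_gt0.
  have [n nP] := power_exceeds (L / y g) mu1.
  have := @bounded n g; rewrite (gtr0_norm g0) => /(_ gL).
  rewrite (form_power _ _ conjugate_form) normrM (gtr0_norm g0) normrX.
  by rewrite ltr_pdivrMr // in nP; lra.
rewrite lt_neqAle le1 andbT.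
have H k := not_integer_eigenvalue k sM conjugate_form conjugate_neq.
have /andP[_ +] := H 1; have /andP[_ +] := H (-1).
rewrite mulrNz mulr1z => m1 m2; rewrite -[1 in X in _ != X](normr1 R) eqr_norm2.
by rewrite negb_or m2.
Qed.

Lemma conjugate_neq0 : mu != 0.
Proof. by have /andP[_] := not_integer_eigenvalue 0 sM conjugate_form conjugate_neq. Qed.

End Eigenforms.

(** * Discontinuities of inflated patches *)

Section Discontinuities.
Variables (R : realType) (s y : {additive lattice -> R}).
Hypothesis sy_det : form_det s y != 0.
Hypothesis s_inj : forall x, s x = 0 -> x = 0.
Hypothesis y_inj : forall x, y x = 0 -> x = 0.
Variables (a b : R).
Hypothesis ab : a < b.
Let vertex (x : lattice) := a <= y x < b.
Variables (P : protoset R) (T : set (ltile P)) (sigma : substitution_rule P).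
Hypothesis T_tiling : tiling T.
Hypothesis T_vertices : vertices T = [set s x | x in [set x | vertex x]].
Hypothesis T_sub : substitution_tiling sigma T.
Let lam := Defs.factor sigma.
Variables (M : 'M[int]_2) (mu : R).
Hypothesis sM : forall x, s (M *m x) = lam * s x.
Hypothesis yM : forall x, y (M *m x) = mu * y x.
Hypothesis mu_neq0 : mu != 0.
Hypothesis mu_lt1 : `|mu| < 1.

Let lamn0 n : 0 < lam ^+ n. Proof. by rewrite exprn_gt0 // factor_gt0. Qed.

Section Code.
Variable rho : R.
Definition patch_offsets : seq lattice := sval (cid (finite_box sy_det (`|rho| + (b - a)))).

(** Indexing the tiles near [x] by lattice offsets puts the codes of all vertices
    in one finite type. *)
Definition patch_code (x : lattice) : {ffun 'I_(size patch_offsets) * label P -> bool} :=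
  [ffun il => `[< T (s (x + nth 0 patch_offsets (il.1 : 'I_(size patch_offsets))), il.2) >]].

Lemma patch_codeP x x' m l : patch_code x = patch_code x' ->
  `|s m| <= rho -> `|y m| <= b - a -> T (s (x + m), l) -> T (s (x' + m), l).
Proof.
move=> cc sm ym.
have mo : m \in patch_offsets.
  rewrite /patch_offsets; case: cid => F /= FP; have := ler_norm rho.
  have := normr_ge0 rho.
  by move=> *; apply: FP; have := ab; lra.
have io : (index m patch_offsets < size patch_offsets)%N by rewrite index_mem.
have /ffunP/(_ (Ordinal io, l)) := cc; rewrite !ffunE /= nth_index // => E Tx.
by apply/asboolP; rewrite -E; apply/asboolP.
Qed.

(** The point at distance [r] from the inflated vertex belongs to the supertile of
    one tile of the patch at [x], and the patch at [x'] has a tile with the same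
    label, hence with the same supertile, in the same place. *)
Lemma same_code_patch n t (B r : R) x x' :
  (forall p, T p -> `|left_end p| <= B ->
     translate t (iter n (substitute sigma) [set p]) `<=` T) ->
  vertex x -> patch_code x = patch_code x' ->
  `|s x| + rho <= B -> `|s x'| + rho <= B -> 0 <= r < lam ^+ n * rho ->
  (exists2 z, vertex z & s z = lam ^+ n * s x + t + r) ->
  exists2 z, vertex z & s z = lam ^+ n * s x' + t + r.
Proof.
move=> tP vx cc xB x'B /andP[r0 rr] [zq vzq szq].
have ln0 := lamn0 n.
have rn0 : 0 <= r / lam ^+ n by rewrite divr_ge0 // ltW.
have rn1 : r / lam ^+ n < rho by rewrite ltr_pdivrMr // mulrC.
have [p Tp /andP[p1 p2]] := tiling_cover (s x + r / lam ^+ n) T_tiling.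
have [lx Tx] := vertex_tile T_tiling T_vertices vx.
have px : s x <= left_end p.
  rewrite leNgt; apply/negP => lt.
  have := len_end (s x, lx); rewrite {1}/left_end /= => lex.
  have := tile_unique (r := s x) T_tiling Tp Tx.
  rewrite [in left_end (_, _)]/left_end /= lexx lex (ltW lt) /=.
  rewrite (le_lt_trans _ p2) ?lerDl // => /(_ isT isT) E.
  by rewrite E /left_end ltxx in lt.
have [z vz zp] := tile_start T_vertices Tp.
case: p => [zz l] in Tp p1 p2 px zp *; rewrite /left_end /= in zp p1 px; subst zz.
pose m := z - x; have zE : z = x + m by rewrite /m addrC subrK.
have sm0 : 0 <= s m by rewrite /m raddfB subr_ge0.
have sm1 : s m < rho by rewrite /m raddfB /=; lra.
have ym : `|y m| <= b - a.
  by move: vx vz; rewrite /m raddfB /= /vertex ler_norml => *; lra.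
have Tx' : T (s (x' + m), l).
  by apply: (patch_codeP cc) => //; rewrite -?zE // ger0_norm // ltW.
have [lq Tq] := vertex_tile T_tiling T_vertices vzq.
have [|q0 Hq0 /andP[q1 q2]] := @supertile_cover R P sigma n (s z, l) (lam ^+ n * s x + r).
  have E : lam ^+ n * s x + r = lam ^+ n * (s x + r / lam ^+ n).
    by rewrite mulrDr [_ * (r / _)]mulrC divfK // gt_eqF.
  by rewrite -/lam E ler_pM2l // ltr_pM2l // p2 andbT.
have inB w : `|s w| + rho <= B -> `|s (w + m)| <= B.
  move=> wB; rewrite raddfD (le_trans (ler_normD _ _)) //= (ger0_norm sm0); lra.
have Tq0 : T (q0.1 + t, q0.2).
  by apply: (tP (s z, l)) => //; [rewrite /left_end /= zE inB|exists q0].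
have q0E : (s zq, lq) = (q0.1 + t, q0.2).
  apply: (tile_unique (r := s zq) T_tiling Tq Tq0).
    by rewrite {1}/left_end /= lexx (len_end (s zq, lq)).
  by move: q1 q2; rewrite /left_end /right_end /= szq => *; apply/andP; split; lra.
case: q0E => q0t _.
have Hq1 := iter_substitute_move (s (x' + m)) Hq0; rewrite -/lam in Hq1.
have Tq1 : T (q0.1 + lam ^+ n * (s (x' + m) - s z) + t, q0.2).
  apply: (tP (s (x' + m), l)) => //; first by rewrite /left_end /= inB.
  by eexists; [exact: Hq1|].
have [w vw] := tile_start T_vertices Tq1.
rewrite /left_end /= => sw; exists w => //; rewrite -sw zE !raddfD /=.
by rewrite szq in q0t; lra.
Qed.

End Code.

(** For a vertex of height [d] the [n]-fold inflation has a vertex of height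
    [a - mu ^+ n * (A - d)], where [A] depends on the position of the inflated
    patch; adding [m] to it gives a point at an end [a] or [b] of the window. *)
Definition discontinuity (rho : R) (n : nat) (A d : R) := exists m,
  0 <= s m < lam ^+ n * rho /\
  (mu ^+ n * (A - d) = y m \/ mu ^+ n * (A - d) = y m - (b - a)).

Lemma power_norm_le1 n : `|mu ^+ n| <= 1.
Proof. by rewrite normrX exprn_ile1 // ltW. Qed.

(** One of the two points lies inside and the other outside the end [c] of the
    window; the sign of [k] decides which. *)
Lemma straddle (c k u u' d : R) : c = a \/ c = b -> k != 0 -> `|k| <= 1 ->
  u < d -> d < u' -> u' - u < b - a ->
  (a <= c + k * (u - d) < b) = (a <= c + k * (u' - d) < b) -> False.
Proof.
move=> cab k0 k1 ud du' uu'; rewrite ler_norml in k1; case/andP: k1 => k1 k2.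
have ud0 : 0 < d - u by rewrite subr_gt0.
have du0 : 0 < u' - d by rewrite subr_gt0.
rewrite -[u - d]opprB mulrN.
case: (ltgtP 0 k) => [kp|kn|k00]; last by rewrite -k00 eqxx in k0.
  have : 0 < k * (u' - d) by rewrite mulr_gt0.
  have : k * (u' - d) <= u' - d by rewrite ler_piMl // ltW.
  have : 0 < k * (d - u) by rewrite mulr_gt0.
  have : k * (d - u) <= d - u by rewrite ler_piMl // ltW.
  move: (k * (u' - d)) (k * (d - u)) => p q q1 q0 p1 p0 E.
  case: cab => cE; rewrite cE in E.
    by have : a <= a + p < b by [lra|]; rewrite -E; lra.
  by have : a <= b - q < b by [lra|]; rewrite E; lra.
have nk : 0 < - k by rewrite oppr_gt0.
have nk1 : - k <= 1 by lra.
have : 0 < - k * (u' - d) by rewrite mulr_gt0.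
have : - k * (u' - d) <= u' - d by rewrite ler_piMl // ltW.
have : 0 < - k * (d - u) by rewrite mulr_gt0.
have : - k * (d - u) <= d - u by rewrite ler_piMl // ltW.
rewrite !mulNr; move: (k * (u' - d)) (k * (d - u)) => p q q1 q0 p1 p0 E.
case: cab => cE; rewrite cE in E.
  by have : a <= a - q < b by [lra|]; rewrite E; lra.
by have : a <= b + p < b by [lra|]; rewrite -E; lra.
Qed.

(** Two vertices whose heights lie on different sides of a discontinuity start
    patches with different vertices after inflation, so their codes differ;
    since there are finitely many codes, the discontinuities of all orders
    occupy boundedly many places. *)
Lemma finitely_many_discontinuities (rho : R) : exists C : finType,
  forall e : R, 0 < e -> exists (A : nat -> R) (g : R -> C),
  forall n d n' d',
    discontinuity rho n (A n) d -> discontinuity rho n' (A n') d' ->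
    a + e < d <= b -> a + e < d' <= b -> g d = g d' -> `|d - d'| < e.
Proof.
pose code := patch_code rho.
exists ({ffun 'I_(size (patch_offsets rho)) * label P -> bool} : finType) => e e0.
have [xs xsP] := vertex_net a b y_inj e0.
have [x0 vx0] : exists x0, vertex x0.
  by have [x /andP[ax xb]] := dense_values y_inj ab; exists x; rewrite /vertex ltW.
have [B BP] := seq_bound s (x0 :: xs).
have [t tP] := choice (fun n => inflate_bounded sy_det T_vertices T_sub n (B + `|rho|)).
have lift n x : x \in x0 :: xs -> vertex x ->
    exists2 x', vertex x' & s x' = lam ^+ n * s x + t n.
  move=> xxs vx; have [l Tx] := vertex_tile T_tiling T_vertices vx.
  apply: (supertile_start T_vertices Tx); apply: tP => //.
  by rewrite (le_trans (BP x xxs)) // lerDl.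
have /choice[z zP] n : exists z, vertex z /\ s z = lam ^+ n * s x0 + t n.
  by have [z vz sz] := lift n x0 (mem_head _ _) vx0; exists z.
(* [x0] serves as the origin of the inflated patch. *)
pose A n := y x0 + (a - y (z n)) / mu ^+ n.
have mun0 n : mu ^+ n != 0 by rewrite expf_neq0.
have liftE n x : x \in xs -> vertex x -> exists2 x',
    s x' = lam ^+ n * s x + t n & y x' = a - mu ^+ n * (A n - y x).
  move=> xxs vx; have [|x' vx' sx'] := lift n x _ vx; first by rewrite inE xxs orbT.
  exists x' => //; have [vz sz] := zP n.
  have -> : x' = z n + M ^+ n *m (x - x0).
    apply/eqP; rewrite -subr_eq0; apply/eqP; apply: s_inj.
    by rewrite raddfB raddfD /= (form_power _ _ sM) raddfB /= sx' sz; ring.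
  by rewrite raddfD /= (form_power _ _ yM) raddfB /= /A; field.
have key n d x x' : x \in xs -> x' \in xs -> vertex x -> vertex x' ->
    code x = code x' -> discontinuity rho n (A n) d -> y x < d -> d < y x' -> False.
  move=> xxs xxs' vx vx' cc [m [sm ym]] xd dx'.
  have [w sw yw] := liftE n x xxs vx; have [w' sw' yw'] := liftE n x' xxs' vx'.
  have xB u : u \in xs -> `|s u| + rho <= B + `|rho|.
    by move=> uxs; rewrite lerD ?ler_norm // BP // inE uxs orbT.
  have half u u' v v' : u \in xs -> u' \in xs -> vertex u -> code u = code u' ->
      s v = lam ^+ n * s u + t n -> s v' = lam ^+ n * s u' + t n ->
      vertex (v + m) -> vertex (v' + m).
    move=> uxs u'xs vu cu sv sv' vm.
    have [|v'' vv'' sv''] := same_code_patch (tP n) vu cu (xB _ uxs) (xB _ u'xs) sm.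
      by exists (v + m); rewrite // raddfD /= sv.
    suff -> : v' + m = v'' by [].
    apply/eqP; rewrite -subr_eq0; apply/eqP; apply: s_inj.
    by rewrite raddfB raddfD /= sv' sv'' subrr.
  have E : vertex (w + m) = vertex (w' + m).
    by apply/idP/idP; [exact: (half x x')|exact: (half x' x)].
  have uu' : y x' - y x < b - a by move: vx vx'; rewrite /vertex; lra.
  have kn : mu ^+ n != 0 := mun0 n.
  case: ym => ym.
    apply: (straddle (or_introl erefl) kn (power_norm_le1 n) xd dx' uu').
    move: E; rewrite /vertex !raddfD /= yw yw' -ym.
    by congr ((a <= _ < b) = (a <= _ < b)); ring.
  have {}ym : y m = mu ^+ n * (A n - d) + (b - a) by rewrite ym subrK.
  apply: (straddle (or_intror erefl) kn (power_norm_le1 n) xd dx' uu').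
  move: E; rewrite /vertex !raddfD /= yw yw' ym.
  by congr ((a <= _ < b) = (a <= _ < b)); ring.
(* The code attached to [d] is that of a vertex slightly below [d]. *)
pose near d := [set x | [/\ x \in xs, vertex x & d - e < y x < d]].
have nearP d : a + e < d <= b -> near d (xget 0 (near d)).
  by move=> /xsP[x xP]; exact: (xgetI 0 xP).
exists A, (fun d => code (xget 0 (near d))) => n d n' d' dn dn' ad ad' cc.
have [x1 x2 /andP[x3 x4]] := nearP d ad.
have [x1' x2' /andP[x3' x4']] := nearP d' ad'.
rewrite ltNge; apply/negP; rewrite ler_normr => /orP[] h.
  by apply: (key n' d' _ _ x1' x1 x2' x2 (esym cc) dn') => //; lra.
by apply: (key n d _ _ x1 x1' x2 x2' cc dn) => //; lra.
Qed.


Let lam_neq_mu : lam != mu.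
Proof.
apply/eqP => E; have := factor_gt1 sigma; rewrite -/lam E => m1.
by have := mu_lt1; rewrite ltNge (le_trans (ltW m1)) // ler_norm.
Qed.

(** If [M] is not unimodular then it increases areas, and the lattice rescaled
    by [M ^- n], for large [n], has short independent vectors. *)
Lemma rescaled_lattice_dense (e : R) : 1 < `|lam * mu| -> 0 < e -> exists n : nat,
  forall s0 y0, exists m, `|s m / lam ^+ n - s0| <= e /\ `|y m / mu ^+ n - y0| <= e.
Proof.
move=> d1 e0; have [C C0 CP] := small_vector y_inj s.
have l1 := factor_gt1 sigma; rewrite -/lam in l1.
have K0 : 0 < C * (1 + lam) / e.
  by rewrite divr_gt0 // mulr_gt0 //; lra.
have mu0 : 0 < `|mu| by rewrite normr_gt0.
have [n nP] := power_exceeds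
  (Num.max (C * (1 + lam) / e) (4 * C ^+ 2 * (1 + lam) / e ^+ 2)) d1.
move: nP; rewrite gt_max normrM exprMn (ger0_norm (ltW (lt_trans ltr01 l1))).
have mn0 : 0 < `|mu| ^+ n by rewrite exprn_gt0.
have mn1 : `|mu| ^+ n <= 1 by rewrite exprn_ile1 // ltW.
have ln0 := lamn0 n.
move=> /andP[n1 n2]; exists n => s0 y0.
have n1' : C * (1 + lam) / e < lam ^+ n.
  by apply: lt_le_trans n1 _; apply: ler_piMr => //; exact: ltW.
pose q := e * lam ^+ n / (C * (1 + lam)).
have CL : 0 < C * (1 + lam) by rewrite mulr_gt0 //; lra.
have q1 : 1 < q.
  by rewrite /q ltr_pdivlMr // mul1r [e * _]mulrC -ltr_pdivrMr.
pose Q := Num.trunc q.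
have /andP[Q1 Q2] : Q%:R <= q < Q.+1%:R by apply: truncn_itv; lra.
have Q0 : (0 < Q)%N by rewrite lt0n; apply/eqP => E; rewrite E in Q2; lra.
have QR1 : 1 <= Q%:R :> R by rewrite ler1n.
rewrite -natr1 in Q2.
have [g [g0 yg sg]] := CP Q Q0.
have sMg : `|s (M *m g)| = lam * `|s g| by rewrite sM normrM gtr0_norm // (lt_trans ltr01).
have yMg : `|y (M *m g)| <= `|y g| by rewrite yM normrM ler_piMl // ltW.
have sB : `|s g| + `|s (M *m g)| <= e * lam ^+ n.
  have -> : e * lam ^+ n = C * q * (1 + lam) by rewrite /q; field; lra.
  rewrite sMg -[X in X + _]mul1r -mulrDl mulrC ler_pM2r; last by lra.
  by rewrite (le_trans sg) // ler_pM2l.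
have yB : `|y g| + `|y (M *m g)| <= e * `|mu| ^+ n.
  have h1 : `|y g| <= 2 * C / q.
    apply: le_trans yg _; rewrite ler_pdivrMr ?ltr0n // mulrAC.
    rewrite ler_pdivlMr; last by lra.
    rewrite [2 * C]mulrC -mulrA ler_pM2l //; lra.
  have h2 : 4 * C / q <= e * `|mu| ^+ n.
    have -> : 4 * C / q = e * (4 * C ^+ 2 * (1 + lam) / e ^+ 2 / lam ^+ n).
      by rewrite /q; field; rewrite !gt_eqF //; lra.
    by rewrite ler_pM2l // ler_pdivrMr // [`|mu| ^+ n * _]mulrC ltW.
  have : 4 * C / q = 2 * C / q + 2 * C / q by ring.
  by lra.
have ln : lam ^+ n != 0 by rewrite gt_eqF.
have mn : mu ^+ n != 0 by rewrite expf_neq0.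
have [|k1 [k2 [ks ky]]] := @round_to_lattice R (s g / lam ^+ n) (y g / mu ^+ n)
   (s (M *m g) / lam ^+ n) (y (M *m g) / mu ^+ n) s0 y0.
  rewrite sM yM [X in X != 0](_ : _ = (mu - lam) * (s g * y g) / (lam ^+ n * mu ^+ n)).
    have ml : mu - lam != 0 by rewrite subr_eq0 eq_sym.
    have sg0 : s g != 0 by apply: contra g0 => /eqP/s_inj ->.
    have yg0 : y g != 0 by apply: contra g0 => /eqP/y_inj ->.
    by rewrite mulf_neq0 ?invr_neq0 ?mulf_neq0.
  by field; rewrite mn ln.
exists (g *~ k1 + M *m g *~ k2); rewrite !raddfD !raddfMz /=.
rewrite -(mulrzl (s g)) -(mulrzl (s (_ *m _))) -(mulrzl (y g)) -(mulrzl (y (_ *m _))).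
rewrite !mulrDl -!mulrA; split.
  apply: le_trans ks _; rewrite !normrM -mulrDl normfV (gtr0_norm ln0).
  by rewrite ler_pdivrMr.
apply: le_trans ky _; rewrite !normrM -mulrDl normfV normrX.
by rewrite ler_pdivrMr.
Qed.

(** Otherwise some order [n] has more well-separated discontinuities than there
    are codes. *)
Lemma inflation_unimodular : `|lam * mu| <= 1.
Proof.
rewrite leNgt; apply/negP => d1.
have [C CP] := finitely_many_discontinuities 1.
(* The [N + 1] discontinuities are sought near the points [a + (i + 2) * h],
   with [2 * h] left free at both ends of the window. *)
pose N := #|C|; pose h := (b - a) / (N + 4)%:R.
have ba0 : 0 < b - a by rewrite subr_gt0.
have h0 : 0 < h by rewrite divr_gt0 // ltr0n addn4.
have hN : h * N%:R + 4 * h = b - a.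
  rewrite [4 * h]mulrC -mulrDr -natrD /h divfK // pnatr_eq0 addn4 //.
have [A [g gP]] := CP (h / 2) ltac:(by rewrite divr_gt0).
pose ep := Num.min (h / 4) (1 / 4).
have ep0 : 0 < ep by rewrite lt_min; apply/andP; split; lra.
have eph : ep <= h / 4 by rewrite ge_min lexx.
have ep1 : ep <= 1 / 4 by rewrite ge_min lexx orbT.
have [n nP] := rescaled_lattice_dense d1 ep0.
have ln0 := lamn0 n.
have mn : mu ^+ n != 0 by rewrite expf_neq0.
pose c (i : nat) := a + h * i%:R + 2 * h.
have /choice[d dP] (i : nat) : exists d, discontinuity 1 n (A n) d /\ `|d - c i| <= h / 4.
  have [m [sm ym]] := nP (1 / 2) (A n - c i).
  exists (A n - y m / mu ^+ n); split.
    exists m; split; last by left; rewrite opprB addrC subrK mulrC divfK.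
    have sE : s m = lam ^+ n * (s m / lam ^+ n) by rewrite mulrC divfK // gt_eqF.
    rewrite sE pmulr_rge0 // ltr_pM2l //.
    by rewrite ler_norml in sm; apply/andP; split; lra.
  by rewrite !ler_norml in ym *; lra.
have dI (i : 'I_N.+1) : a + h / 2 < d i <= b.
  have [_] := dP i; rewrite ler_norml /c => di.
  have : h * i%:R <= h * N%:R by rewrite ler_pM2l // ler_nat -ltnS.
  have : 0 <= h * i%:R by rewrite mulr_ge0 // ltW.
  by lra.
have : injective (fun i : 'I_N.+1 => g (d i)).
  move=> i j gij; apply: contrapT => nij.
  have [Di di] := dP i; have [Dj dj] := dP j.
  have := gP n (d i) n (d j) Di Dj (dI i) (dI j) gij.
  wlog lt : i j nij {gij} di dj {Di Dj} / (i < j)%N.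
    move=> W; case: (ltngtP i j) => [lt|lt|/val_inj//]; first exact: (W i j).
    by rewrite distrC; apply: (W j i) => //; exact: nesym.
  have : h * i%:R + h <= h * j%:R.
    by rewrite -[X in _ + X]mulr1 -mulrDr ler_pM2l // natr1 ler_nat.
  by move: di dj; rewrite !ler_norml ltr_norml /c; lra.
by move/leq_card; rewrite card_ord ltnn.
Qed.

(** Discontinuities coming from the two ends of the window differ by
    [(b - a) / mu ^+ n] modulo the values of [y]. As they occupy boundedly many
    places, two different [n] must give the same difference. *)
Lemma window_length_relation :
  exists n n' x, (n < n')%N /\ (mu ^- n - mu ^- n') * (b - a) = y x.
Proof.
apply: contrapT => H.
have ba0 : 0 < b - a by rewrite subr_gt0.
have [|rho0 hit] := strip_hit s_inj y_inj sM yM (e := (b - a) / 4) lam_neq_mu (ltW mu_lt1).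
  by rewrite divr_gt0.
have rho00 : 0 <= rho0 by have [x [/(le_trans (normr_ge0 _))]] := hit 0 0.
pose rho := 2 * rho0 + 1.
have [C CP] := finitely_many_discontinuities rho.
pose K := #|{: C * C}|.
have mn n : mu ^+ n != 0 by rewrite expf_neq0.
pose D n n' := (mu ^- n - mu ^- n') * (b - a).
pose Ds := [seq D n n' | n <- iota 0 K.+1, n' <- iota 0 K.+1].
pose BD := \sum_(r <- Ds) `|r|.
have BDP r : r \in Ds -> `|r| <= BD.
  by move=> rD; rewrite /BD (big_rem _ rD) /= lerDl sumr_ge0.
have [F FP] := finite_box sy_det (4 * rho + BD + 2).
(* By assumption [dl] bounds from below the distance of all possible differences
   from the values of [y] that can be involved. *)
have [dl dl0 dlP] := seq_gap [seq `|r - y x| | r <- Ds, x <- F].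
pose e := Num.min (dl / 2) (Num.min 1 ((b - a) / 8)).
have e0 : 0 < e by rewrite !lt_min !divr_gt0 // ltr01.
have [e1 e2 e3] : [/\ e <= dl / 2, e <= 1 & e <= (b - a) / 8].
  by rewrite /e !ge_min !lexx !orbT.
have [A [g gP]] := CP e e0.
have pick n (c : R) : exists x, [/\ 0 <= s x < rho, `|y x - c| <= (b - a) / 4 &
   0 <= s (M ^+ n *m x) < lam ^+ n * rho /\ y (M ^+ n *m x) = mu ^+ n * y x].
  have [x [sx yx]] := hit rho0 c; exists x.
  have sx' : 0 <= s x < rho by rewrite ler_norml in sx; rewrite /rho; lra.
  split => //; split; last by rewrite (form_power _ _ yM).
  by rewrite (form_power _ _ sM) pmulr_rge0 // ltr_pM2l.
have /choice[xA xAP] n := pick n (A n - (a + (b - a) / 2)).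
have /choice[xB xBP] n := pick n (A n + (b - a) / mu ^+ n - (a + (b - a) / 2)).
pose dA n := A n - y (xA n); pose dB n := A n + (b - a) / mu ^+ n - y (xB n).
have dAP n : discontinuity rho n (A n) (dA n).
  have [_ _ [sx yx]] := xAP n; exists (M ^+ n *m xA n); split => //; left.
  by rewrite yx /dA opprB addrC subrK.
have dBP n : discontinuity rho n (A n) (dB n).
  have [_ _ [sx yx]] := xBP n; exists (M ^+ n *m xB n); split => //; right.
  by rewrite yx /dB; field.
have dAI n : a + e < dA n <= b.
  by have [_ + _] := xAP n; rewrite /dA ler_norml; lra.
have dBI n : a + e < dB n <= b.
  by have [_ + _] := xBP n; rewrite /dB ler_norml; lra.
pose G (n : 'I_K.+1) := (g (dA n), g (dB n)).
have : ~ injective G by move/leq_card; rewrite card_ord ltnn.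
apply => n n' [gA gB]; apply: contrapT => nn'.
wlog lt : n n' gA gB nn' / (n < n')%N.
  move=> W; case: (ltngtP n n') => [lt|lt|/val_inj//]; first exact: (W n n').
  by apply: (W n' n) => //; exact: nesym.
have hA := gP _ _ _ _ (dAP n) (dAP n') (dAI n) (dAI n') gA.
have hB := gP _ _ _ _ (dBP n) (dBP n') (dBI n) (dBI n') gB.
pose X := xB n - xA n - xB n' + xA n'.
have DX : D n n' - y X = (dB n - dB n') - (dA n - dA n').
  by rewrite /D /X !(raddfD, raddfB) /= /dA /dB; ring.
have DXe : `|D n n' - y X| < 2 * e.
  by rewrite DX; rewrite !ltr_norml in hA hB *; lra.
have Din : D n n' \in Ds.
  by apply: allpairs_f; rewrite mem_iota /=; exact: ltn_ord.
have XF : X \in F.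
  apply: FP.
    have [+ _ _] := xAP n; have [+ _ _] := xAP n'.
    have [+ _ _] := xBP n; have [+ _ _] := xBP n'.
    rewrite /X !(raddfD, raddfB) /= ler_norml => *.
    have : 0 <= BD by rewrite sumr_ge0.
    by lra.
  have := BDP _ Din; have : 0 <= rho by rewrite /rho; lra.
  by rewrite !ler_norml; rewrite ltr_norml in DXe; lra.
have : dl <= `|D n n' - y X|.
  apply: dlP; first exact: allpairs_f.
  rewrite normr_gt0 subr_eq0; apply/eqP => E; apply: H.
  by exists n, n', X.
lra.
Qed.

End Discontinuities.

(** * Primitivity and the length of the window *)

Lemma mulmx_ux (N : 'M[int]_2) : N *m ux = ux *~ N 0 0 + uy *~ N 1 0.
Proof. by rewrite [LHS]latticeE !mulmx2E !mxE /= !mulr1 !mulr0 !addr0. Qed.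

Lemma mulmx_uy (N : 'M[int]_2) : N *m uy = ux *~ N 0 1 + uy *~ N 1 1.
Proof. by rewrite [LHS]latticeE !mulmx2E !mxE /= !mulr1 !mulr0 !add0r. Qed.

Lemma uy_neq0 : uy != 0.
Proof. by apply/eqP => /matrixP/(_ 1 0); rewrite !mxE. Qed.

Section UnimodularAutomorphism.
Variables (R : realType) (s y : {additive lattice -> R}).
Hypothesis s_inj : forall x, s x = 0 -> x = 0.
Hypothesis y_inj : forall x, y x = 0 -> x = 0.
Variables (lam mu : R) (M : 'M[int]_2).
Hypothesis lam_gt1 : 1 < lam.
Hypothesis mu_lt1 : `|mu| < 1.
Hypothesis sM : forall x, s (M *m x) = lam * s x.
Hypothesis yM : forall x, y (M *m x) = mu * y x.

Lemma power_neq n : (0 < n)%N -> lam ^+ n != mu ^+ n.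
Proof.
move=> n0; apply/eqP => E; have : `|mu ^+ n| < 1 by rewrite normrX exprn_ilt1 -?lt0n.
rewrite -E; have : 1 < lam ^+ n by rewrite exprn_egt1 // -lt0n.
by have := ler_norm (lam ^+ n); lra.
Qed.

(** An off-diagonal zero would give an integer eigenvalue; a diagonal zero of
    the square of [M ^+ 2] would force the trace of [M ^+ 2], which exceeds 1,
    to divide 1. *)
Lemma automorphism_primitive : GL2Z M -> primitive_mx M.
Proof.
move=> detM; exists 4%N => i j.
pose N := M ^+ 4; rewrite -/N.
have sN x : s (N *m x) = lam ^+ 4 * s x by exact: form_power.
have yN x : y (N *m x) = mu ^+ 4 * y x by exact: form_power.
have noint k : lam ^+ 4 != k%:~R.
  by case/andP: (not_integer_eigenvalue s_inj y_inj k sN yN (@power_neq 4 isT)).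
pose B := M ^+ 2.
have sB x : s (B *m x) = lam ^+ 2 * s x by exact: form_power.
have detB : \det B = 1.
  by rewrite /B expr2 det_mulmx; case: detM => ->; rewrite ?mulr1 ?mulrNN ?mulr1.
have lam2 : 1 < lam ^+ 2 by rewrite exprn_egt1.
have trB : 1 < (\tr B)%:~R :> R.
  have := conjugate_mul s_inj sB; rewrite detB /conjugate_eigenvalue mulr1z.
  move: (lam ^+ 2) lam2 (\tr B)%:~R => l l1 t E; rewrite ltNge; apply/negP => t1.
  have : l * (t - l) <= l * (1 - l) by rewrite ler_pM2l; lra.
  have : 0 < (l - 1) * l by apply: mulr_gt0; lra.
  by lra.
have NB : N = B *m B by rewrite /N /B -[4%N]/(2 + 2)%N exprD.
have trB1 : 1 < \tr B by rewrite -(ltr_int R) mulr1z.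
have trn k : B k k * \tr B <> 1.
  move/(congr1 absz)/eqP; rewrite abszM muln_eq1 => /andP[_ /eqP t1].
  by move: (\tr B) trB1 t1 => t; lia.
have Nij k l : N k l = B k 0 * B 0 l + B k 1 * B 1 l.
  rewrite NB mxE !big_ord_recl big_ord0 addr0.
  by congr (B k _ * B _ l + B k _ * B _ l); exact: val_inj.
rewrite det2E in detB; rewrite tr2E in trn; apply/eqP => N0.
case: (ord2E i) (ord2E j) => iE [jE|jE]; rewrite {}iE {}jE in N0.
- by apply: (trn 0); rewrite -[RHS]addr0 -N0 Nij -detB; ring.
- have /eqP := noint (N 1 1); apply; apply: (@mulIf _ (s uy)).
    by apply: contra uy_neq0 => /eqP/s_inj ->.
  by rewrite -sN mulmx_uy N0 mulr0z add0r raddfMz mulrzl.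
- have /eqP := noint (N 0 0); apply; apply: (mulIf (inj_neq0 s_inj)).
  by rewrite -sN mulmx_ux N0 mulr0z addr0 raddfMz mulrzl.
- by apply: (trn 1); rewrite -[RHS]addr0 -N0 Nij -detB; ring.
Qed.

(** [M ^+ j - 1] is invertible over the rationals, so that a vector can be
    divided by [mu ^+ j - 1] up to an integer. *)
Lemma commensurable_length (L : R) n n' x : mu != 0 -> (n < n')%N ->
  (mu ^- n - mu ^- n') * L = y x ->
  exists kap p0, (0 < kap)%N /\ kap%:R * L = y p0.
Proof.
move=> mu0 nn' E; pose j := (n' - n)%N.
have j0 : (0 < j)%N by rewrite subn_gt0.
pose A := M ^+ j - 1.
have mulA (z : lattice) : A *m z = M ^+ j *m z - z by rewrite mulmxBl mul1mx.
have sA z : s (A *m z) = (lam ^+ j - 1) * s z.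
  by rewrite mulA raddfB /= (form_power _ _ sM) mulrBl mul1r.
have yA z : y (A *m z) = (mu ^+ j - 1) * y z.
  by rewrite mulA raddfB /= (form_power _ _ yM) mulrBl mul1r.
have muj : mu ^+ j - 1 != 0.
  rewrite subr_eq0; apply/eqP => m1.
  have : `|mu ^+ j| < 1 by rewrite normrX exprn_ilt1 -?lt0n.
  by rewrite m1 normr1 ltxx.
have detA : \det A != 0.
  apply/eqP => dA.
  have trA (z : lattice) : A *m z = z *~ \tr A.
    have A_inj (u : lattice) : A *m u = 0 -> u = 0.
      move=> Au; apply: y_inj; apply: (mulfI muj).
      by rewrite -yA Au raddf0 mulr0.
    apply/eqP; rewrite -subr_eq0; apply/eqP; apply: A_inj.
    rewrite mulmxBr cayley_hamilton2 dA mulr0z subr0.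
    by rewrite (raddfMz (mulmx A)) /= subrr.
  have H (f : {additive lattice -> R}) (k : R) : f ux != 0 ->
      (forall z, f (A *m z) = k * f z) -> k = (\tr A)%:~R.
    by move=> f0 fA; apply: (mulIf f0); rewrite -fA trA raddfMz mulrzl.
  have := H y _ (inj_neq0 y_inj) yA; rewrite -(H s _ (inj_neq0 s_inj) sA).
  by move/(addIr _)/eqP; rewrite eq_sym (negPf (power_neq j0)).
have yL : y (M ^+ n' *m x) = (mu ^+ j - 1) * L.
  rewrite (form_power _ _ yM) -E mulrA mulrBr mulfV ?expf_neq0 //; congr ((_ - _) * _).
  by rewrite -{1}(subnK (ltnW nn')) exprD mulfK // expf_neq0.
pose z := \adj A *m (M ^+ n' *m x).
have yz : y z = (\det A)%:~R * L.
  apply: (mulfI muj); rewrite -yA /z mulmxA mul_mx_adj mul_scalar_mx mulrCA -yL.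
  by rewrite -{1}[\det A]intz scaler_int raddfMz mulrzl.
exists (absz (\det A)), (z *~ sgz (\det A)); split; first by rewrite absz_gt0.
rewrite raddfMz /= yz -[_ *~ sgz _]mulrzr mulrAC -intrM; congr (_ * _).
by rewrite mulrC -abszEsg.
Qed.

End UnimodularAutomorphism.

Theorem substitution_automorphism (R : realType) (s y : {additive lattice -> R})
    (a b : R) :
  form_det s y != 0 -> a < b ->
  nonperiodic [set s x | x in [set x | a <= y x < b]] ->
  admits_substitution [set s x | x in [set x | a <= y x < b]] ->
  exists (M : 'M[int]_2) (lam mu : R),
  [/\ GL2Z M /\ primitive_mx M, 1 < `|lam| /\ `|mu| < 1,
      (forall x, s (M *m x) = lam * s x), (forall x, y (M *m x) = mu * y x)
    & exists kap p0, (0 < kap)%N /\ kap%:R * (b - a) = y p0].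
Proof.
move=> D0 ab hnp [P [T [sigma [TT TX Tsub]]]].
have y_inj := nonperiodic_inj D0 hnp.
have s_inj := form_injective D0 y_inj ab TT TX Tsub hnp.
have [M sM] := form_matrix (inflate_form D0 y_inj ab TT TX Tsub).
have lam1 := factor_gt1 sigma.
have ba0 : 0 < b - a by rewrite subr_gt0.
have bounded n m : `|y m| < b - a -> `|y (M ^+ n *m m)| < b - a.
  move=> ym; have [m' ym' sm'] := lift_difference D0 y_inj TT TX Tsub n ym.
  suff -> : M ^+ n *m m = m' by [].
  apply/eqP; rewrite -subr_eq0; apply/eqP; apply: s_inj.
  by rewrite raddfB /= (form_power _ _ sM) sm' subrr.
set lam := Defs.factor sigma in sM lam1.
pose mu := conjugate_eigenvalue lam M.
have yM : forall x, y (M *m x) = mu * y x.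
  by move=> x; exact: (conjugate_form s_inj y_inj sM lam1 ba0 bounded).
have mu1 : `|mu| < 1 by exact: (conjugate_lt1 s_inj y_inj sM lam1 ba0 bounded).
have mu0 : mu != 0 by exact: (conjugate_neq0 s_inj y_inj sM lam1 ba0 bounded).
have lam_mu := conjugate_mul s_inj sM.
have dM : GL2Z M.
  have := inflation_unimodular D0 s_inj y_inj ab TT TX Tsub sM yM mu0 mu1.
  rewrite -/lam lam_mu -intr_norm -[1]/(1%:~R) ler_int => d1.
  have d0 : \det M != 0.
    by rewrite -(intr_eq0 R) -lam_mu mulf_neq0 // gt_eqF // (lt_trans ltr01).
  by rewrite /GL2Z; move: (\det M) d0 d1 => d; lia.
have [n [n' [x [nn' E]]]] := window_length_relation D0 s_inj y_inj ab TT TX Tsub sM yM mu0 mu1.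
exists M, lam, mu; split => //.
- by split => //; exact: (automorphism_primitive s_inj y_inj lam1 mu1 sM yM).
- by split => //; rewrite gtr0_norm // (lt_trans ltr01).
- exact: (commensurable_length s_inj y_inj lam1 mu1 sM yM mu0 nn' E).
Qed.

(** * Projection tilings in coordinates *)

Section CoordinateForms.
Variable R : realType.

Definition plane_form (c0 c1 : R) (u : 'cV[R]_2) : R := c0 * u 0 0 + c1 * u 1 0.

Definition coord_form (c0 c1 : R) (x : lattice) : R :=
  c0 * (x 0 0)%:~R + c1 * (x 1 0)%:~R.

Lemma coord_form_is_additive c0 c1 : zmod_morphism (coord_form c0 c1).
Proof. by move=> x x'; rewrite /coord_form !mxE !intrD !mulrDr !rmorphN /= !mulrN; ring. Qed.

HB.instance Definition _ c0 c1 :=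
  GRing.isZmodMorphism.Build lattice R (coord_form c0 c1) (coord_form_is_additive c0 c1).

Lemma coord_formE c0 c1 x : coord_form c0 c1 x = plane_form c0 c1 (map_mx intr x).
Proof. by rewrite /coord_form /plane_form !mxE. Qed.

Lemma coord_form_det c0 c1 d0 d1 :
  form_det (coord_form c0 c1) (coord_form d0 d1) = c0 * d1 - c1 * d0.
Proof. by rewrite /form_det /= /coord_form !mxE /=; ring. Qed.

Lemma plane_form_lin c0 c1 k l (u u' : 'cV[R]_2) :
  plane_form c0 c1 (k *: u + l *: u') = k * plane_form c0 c1 u + l * plane_form c0 c1 u'.
Proof. by rewrite /plane_form !mxE; ring. Qed.

Lemma plane_vectorE (u : 'cV[R]_2) : u = u 0 0 *: e_x R + u 1 0 *: e_y R.
Proof.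
apply/matrixP => i j; rewrite !(ord1 j) !mxE.
by case: (ord2E i) => ->; rewrite /= ?mulr1 ?mulr0 ?addr0 ?add0r.
Qed.

Lemma plane_mulmx (M : 'M[int]_2) (u u' : 'cV[R]_2) k l :
  map_mx intr M *m (k *: u + l *: u')
  = k *: (map_mx intr M *m u) + l *: (map_mx intr M *m u').
Proof. by rewrite mulmxDr -!scalemxAr. Qed.

(** An identity between linear forms can be tested on the lattice. *)
Lemma plane_form_eigen (M : 'M[int]_2) c0 c1 k :
  (forall x, coord_form c0 c1 (M *m x) = k * coord_form c0 c1 x) ->
  forall u, plane_form c0 c1 (map_mx intr M *m u) = k * plane_form c0 c1 u.
Proof.
move=> H u; have E x : plane_form c0 c1 (map_mx intr M *m map_mx intr x)
    = k * plane_form c0 c1 (map_mx intr x).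
  by rewrite -map_mxM -!coord_formE.
have ex : e_x R = map_mx intr ux by rewrite map_delta_mx.
have ey : e_y R = map_mx intr uy by rewrite map_delta_mx.
rewrite (plane_vectorE u) plane_mulmx !plane_form_lin ex ey !E; ring.
Qed.

End CoordinateForms.

Section RationalSpan.
Variables (R : realType) (lam al : R) (p q : int).
Hypothesis lamE : lam = p%:~R + q%:~R * al.

Lemma ratr_cancel_denq (r : rat) : (denq r)%:~R * ratr r = (numq r)%:~R :> R.
Proof. by rewrite /ratr mulrC divfK // intr_eq0 denq_neq0. Qed.

Lemma Q_adjoin_integral (L : R) : Q_adjoin lam L ->
  exists (kap : nat) (i j : int), (0 < kap)%N /\ kap%:R * L = i%:~R + j%:~R * al.
Proof.
case=> r1 _ [r2 _ <-].
exists (absz (denq r1 * denq r2)),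
  (numq r1 * denq r2 + numq r2 * denq r1 * p), (numq r2 * denq r1 * q).
split; first by rewrite absz_gt0 mulf_neq0 ?denq_neq0.
have -> : (absz (denq r1 * denq r2))%:R = (denq r1)%:~R * (denq r2)%:~R :> R.
  by rewrite -[LHS]/((Posz _)%:~R) -intrM gtz0_abs // mulr_gt0 ?denq_gt0.
by rewrite !(intrD, intrM) lamE -!ratr_cancel_denq; ring.
Qed.

Lemma integral_Q_adjoin (L : R) (kap : nat) (i j : int) : q != 0 -> (0 < kap)%N ->
  kap%:R * L = i%:~R + j%:~R * al -> Q_adjoin lam L.
Proof.
move=> q0 k0 E.
have kR : kap%:R != 0 :> R by rewrite pnatr_eq0 -lt0n.
have qR : q%:~R != 0 :> R by rewrite intr_eq0.
exists ((i%:~R - j%:~R * p%:~R / q%:~R) / kap%:R) => //.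
exists (j%:~R / q%:~R / kap%:R) => //.
rewrite !(fmorph_div, rmorphB, rmorphM) /= !ratr_int ratr_nat.
by apply: (mulfI kR); rewrite E lamE; field; rewrite qR kR.
Qed.

End RationalSpan.

Lemma mem_leigenspace (R : realType) (M : 'M[int]_2) (k : R) u :
  (u \in passmx.leigenspace (real_action R M) k) = (map_mx intr M *m u == k *: u).
Proof.
rewrite memv_ker add_lfunE opp_lfunE scale_lfunE id_lfunE subr_eq0.
by rewrite /real_action lfunE.
Qed.

Lemma GL2Z_unitmx (M : 'M[int]_2) : GL2Z M -> M \in unitmx.
Proof. by rewrite unitmxE => -[] ->; rewrite ?unitr1 ?unitrN1. Qed.

Section ProjectionTiling.
Variables (R : realType) (V W : {vspace 'cV[R]_2}).
Hypothesis V_line : is_line V.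
Hypothesis W_line : is_line W.
Hypothesis VW : V <> W.
Hypothesis V_axis : ~ axis_parallel V.
Variable v : 'cV[R]_2.
Hypothesis vV : v \in V.
Hypothesis v1 : unit_vector v.

Lemma direction_neq0 : v != 0.
Proof.
apply/eqP => v0; move: v1; rewrite /unit_vector v0 big1 => [/eqP|i _].
  by rewrite eq_sym oner_eq0.
by rewrite mxE expr0n.
Qed.

Lemma line_direction (U : {vspace 'cV[R]_2}) u :
  is_line U -> u \in U -> u != 0 -> U = <[u]>%VS.
Proof.
move=> U1 uU u0; apply/esym/eqP; rewrite eqEdim -memvE uU /= dim_vline u0.
by rewrite U1.
Qed.

Let w := vpick W.

Lemma w_in : w \in W. Proof. exact: memv_pick. Qed.

Lemma w_neq0 : w != 0.
Proof. by rewrite vpick0 -dimv_eq0 W_line. Qed.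

Lemma VE : V = <[v]>%VS.
Proof. exact: line_direction V_line vV direction_neq0. Qed.

Lemma WE : W = <[w]>%VS.
Proof. exact: line_direction W_line w_in w_neq0. Qed.

Lemma v_x_neq0 : v 0 0 != 0.
Proof.
apply/eqP => v0; apply: V_axis; right.
have vy : v = v 1 0 *: e_y R by rewrite {1}[v]plane_vectorE v0 scale0r add0r.
apply: line_direction => //.
  have -> : e_y R = (v 1 0)^-1 *: v.
    rewrite {2}vy scalerA mulVf ?scale1r //; apply: contra direction_neq0 => /eqP v10.
    by rewrite vy v10 scale0r.
  exact: memvZ.
by apply/eqP => /matrixP/(_ 1 0); rewrite !mxE /= => /eqP; rewrite oner_eq0.
Qed.

Definition direction_det := v 0 0 * w 1 0 - v 1 0 * w 0 0.

Lemma direction_det_neq0 : direction_det != 0.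
Proof.
apply/eqP => D0; apply: VW; rewrite WE; apply: line_direction w_neq0 => //.
have -> : w = (w 0 0 / v 0 0) *: v.
  apply/matrixP => i j; rewrite !(ord1 j) mxE.
  have v0 := v_x_neq0; case: (ord2E i) => ->; first by rewrite divfK.
  by apply: (mulIf v0); rewrite mulrAC divfK // mulrC; move: D0; rewrite /direction_det; lra.
exact: memvZ.
Qed.

(** The forms [S] and [Y] below are the coordinate along [V] parallel to [W] and
    the height on the vertical axis parallel to [V]. *)
Definition slope := v 1 0 / v 0 0.

Let S u := plane_form (w 1 0 / direction_det) (- w 0 0 / direction_det) u.
Let Y u := plane_form (- slope) 1 u.

Lemma along_v : S v = 1.
Proof. by have := direction_det_neq0; rewrite /S /plane_form /direction_det => D; field. Qed.

Lemma along_w : S w = 0.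
Proof. by have := direction_det_neq0; rewrite /S /plane_form => D; field. Qed.

Lemma height_v : Y v = 0.
Proof. by have := v_x_neq0; rewrite /Y /plane_form /slope => v0; field. Qed.

Lemma height_w : Y w = direction_det / v 0 0.
Proof. by have := v_x_neq0; rewrite /Y /plane_form /slope /direction_det => v0; field. Qed.

Lemma height_w_neq0 : Y w != 0.
Proof. by rewrite height_w mulf_neq0 ?invr_neq0 ?v_x_neq0 ?direction_det_neq0. Qed.

Lemma decompose u : u = S u *: v + (Y u / Y w) *: w.
Proof.
have D := direction_det_neq0; have v0 := v_x_neq0; rewrite /direction_det in D.
rewrite height_w.
apply/matrixP => i j; rewrite !(ord1 j) !mxE /S /Y /plane_form /slope /direction_det.
by case: (ord2E i) => ->; field; rewrite v0 D.
Qed.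

Lemma mem_V u : (u \in V) = (Y u == 0).
Proof.
apply/idP/eqP => [|Yu].
  rewrite VE => /vlineP[k ->]; have := plane_form_lin (- slope) 1 k 0 v 0.
  by rewrite scaler0 addr0 mul0r addr0 -/(Y v) -/(Y (k *: v)) height_v mulr0.
by rewrite (decompose u) Yu mul0r scale0r addr0 memvZ.
Qed.

Lemma mem_W u : (u \in W) = (S u == 0).
Proof.
apply/idP/eqP => [|Su].
  rewrite WE => /vlineP[k ->].
  have := plane_form_lin (w 1 0 / direction_det) (- w 0 0 / direction_det) k 0 w 0.
  by rewrite scaler0 addr0 mul0r addr0 -/(S w) -/(S (k *: w)) along_w mulr0.
by rewrite (decompose u) Su scale0r add0r memvZ // w_in.
Qed.

Lemma daddv_piE u : daddv_pi V W u = S u *: v.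
Proof.
have cap : (V :&: W)%VS = 0%VS.
  apply/eqP; rewrite -subv0; apply/subvP => z.
  rewrite memv_cap mem_V mem_W => /andP[/eqP Yz /eqP Sz].
  by rewrite (decompose z) Yz Sz mul0r !scale0r addr0 mem0v.
have piw : daddv_pi V W w = 0.
  have cap' : (W :&: V)%VS = 0%VS by rewrite capvC.
  have := daddv_pi_add (w := w) cap; rewrite (daddv_pi_id cap' w_in).
  have -> : w \in (V + W)%VS by rewrite (subvP (addvSr V W)) // w_in.
  by move=> /(_ isT)/eqP; rewrite -subr_eq0 addrK => /eqP.
by rewrite {1}(decompose u) linearD !linearZ /= piw scaler0 addr0 (daddv_pi_id cap vV).
Qed.

Definition along_form := coord_form (w 1 0 / direction_det) (- w 0 0 / direction_det).
Definition height_form (k : R) := coord_form (- (k * slope)) k.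

Lemma height_formE k x : height_form k x = k * Y (map_mx intr x).
Proof. by rewrite /height_form coord_formE /Y /plane_form; ring. Qed.

Lemma projection_tilingE (Omega : set R) : projection_tiling V W Omega v
  = [set along_form x | x in [set x | Omega (height_form 1 x)]].
Proof.
apply/seteqP; split => [t|_ [x Ox <-]].
  rewrite /projection_tiling /projection_vertices /=.
  move=> [_ [[x _ <-] [z /= zV [h Oh hE]]]]; rewrite daddv_piE => tE.
  exists x.
    rewrite /= height_formE mul1r -hE.
    have := plane_form_lin (- slope) 1 1 h z (e_y R).
    rewrite !scale1r -/(Y (z + h *: e_y R)) => ->.
    move: zV; rewrite mem_V => /eqP; rewrite /Y => ->.
    by rewrite /plane_form !mxE /= !mulr0 !add0r !mulr1.
  move/eqP: tE; rewrite -subr_eq0 -scalerBl scaler_eq0 (negPf direction_neq0).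
  by rewrite orbF subr_eq0 => /eqP <-; rewrite /along_form coord_formE.
rewrite /projection_tiling /projection_vertices /=.
exists (map_mx intr x); last by rewrite daddv_piE /along_form coord_formE.
split; first by exists x.
rewrite /strip /= height_formE mul1r in Ox *.
exists (map_mx intr x - Y (map_mx intr x) *: e_y R).
  rewrite /= mem_V.
  have := plane_form_lin (- slope) 1 1 (- Y (map_mx intr x)) (map_mx intr x) (e_y R).
  rewrite scale1r scaleNr /Y => ->; move: (plane_form _ _ (map_mx _ _)) => h.
  by rewrite /plane_form !mxE /= mulr0 add0r !mulr1 mul1r subrr.
by exists (Y (map_mx intr x)) => //; rewrite subrK.
Qed.

Lemma forms_det_neq0 k : k != 0 -> form_det along_form (height_form k) != 0.
Proof.
move=> k0; rewrite coord_form_det.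
have D := direction_det_neq0; have v0 := v_x_neq0.
have -> : w 1 0 / direction_det * k - - w 0 0 / direction_det * - (k * slope) = k / v 0 0.
  by rewrite /slope; move: D; rewrite /direction_det => D; field; rewrite v0 D.
by rewrite mulf_neq0 ?invr_neq0.
Qed.

Section Eigenlines.
Variables (M : 'M[int]_2) (lam mu : R).
Let RM : 'M[R]_2 := map_mx intr M.

Lemma lines_of_eigenforms k : k != 0 -> lam != mu ->
  (forall x, along_form (M *m x) = lam * along_form x) ->
  (forall x, height_form k (M *m x) = mu * height_form k x) ->
  V = passmx.leigenspace (real_action R M) lam /\
  W = passmx.leigenspace (real_action R M) mu.
Proof.
move=> k0 lm sM yM; have SM := plane_form_eigen sM.
have YM u : Y (RM *m u) = mu * Y u.
  have kY z : plane_form (- (k * slope)) k z = k * Y z by rewrite /Y /plane_form; ring.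
  by apply: (mulfI k0); rewrite mulrCA -!kY; exact: (plane_form_eigen yM).
have eigenV u : Y u = 0 -> RM *m u = lam *: u.
  move=> Yu; rewrite (decompose (RM *m u)) YM Yu mulr0 mul0r scale0r addr0.
  by rewrite /S SM -scalerA -/(S u) {2}(decompose u) Yu mul0r scale0r addr0.
have eigenW u : S u = 0 -> RM *m u = mu *: u.
  move=> Su; rewrite (decompose (RM *m u)) YM /S SM -/(S u) Su mulr0 scale0r add0r.
  by rewrite -mulrA -scalerA {2}(decompose u) Su scale0r add0r.
have zero (z : R) : lam * z = mu * z -> z = 0.
  move/eqP; rewrite -subr_eq0 -mulrBl mulf_eq0 subr_eq0 (negPf lm) /=.
  by move/eqP.
split; apply/vspaceP => u; rewrite mem_leigenspace.
  rewrite mem_V; apply/eqP/eqP => [/eigenV //|E]; apply: zero.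
  by rewrite -YM E /Y /plane_form !mxE; ring.
rewrite mem_W; apply/eqP/eqP => [/eigenW //|E]; apply: zero.
by rewrite -SM -/RM E /S /plane_form !mxE; ring.
Qed.

Hypothesis V_eigen : V = passmx.leigenspace (real_action R M) lam.
Hypothesis W_eigen : W = passmx.leigenspace (real_action R M) mu.

Lemma eigenforms_of_lines k :
  (forall x, along_form (M *m x) = lam * along_form x) /\
  (forall x, height_form k (M *m x) = mu * height_form k x).
Proof.
have Mv : RM *m v = lam *: v.
  by apply/eqP; rewrite -mem_leigenspace -V_eigen.
have Mw : RM *m w = mu *: w.
  by apply/eqP; rewrite -mem_leigenspace -W_eigen w_in.
have ME u : RM *m u = (lam * S u) *: v + (mu * (Y u / Y w)) *: w.
  by rewrite {1}(decompose u) plane_mulmx -/RM Mv Mw !scalerA ![_ * mu]mulrC ![_ * lam]mulrC.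
split=> x.
  rewrite /along_form !coord_formE map_mxM -/RM ME plane_form_lin.
  by rewrite -/(S v) -/(S w) along_v along_w mulr1 mulr0 addr0.
rewrite !height_formE map_mxM -/RM ME {1}/Y plane_form_lin -/(Y v) -/(Y w) height_v.
by rewrite mulr0 add0r -!mulrA mulVf ?height_w_neq0 // mulr1 mulrCA.
Qed.

(** The first coordinate of [M v = lam v]. *)
Lemma eigenvalue_slope : lam = (M 0 0)%:~R + (M 0 1)%:~R * slope.
Proof.
have Mv : RM *m v = lam *: v.
  by apply/eqP; rewrite -mem_leigenspace -V_eigen.
apply: (mulIf v_x_neq0); have /matrixP/(_ 0 0) := Mv; rewrite [RHS]mxE => <-.
rewrite mxE !big_ord_recl big_ord0 addr0 !mxE /slope.
have -> : lift 0 0 = 1 :> 'I_2 by exact: val_inj.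
by have := v_x_neq0 => v0; field.
Qed.

(** Otherwise [lam] is an integer that divides the determinant. *)
Lemma slope_coefficient_neq0 : GL2Z M -> 1 < `|lam| -> M 0 1 != 0.
Proof.
move=> detM lam1; apply/eqP => M01; move: lam1; rewrite eigenvalue_slope M01 mul0r addr0.
rewrite -intr_norm -[1]/(1%:~R) ltr_int.
rewrite /GL2Z det2E M01 mul0r subr0 in detM.
have : absz (M 0 0 * M 1 1) = 1%N by case: detM => ->.
by rewrite abszM => /eqP; rewrite muln_eq1 => /andP[/eqP]; lia.
Qed.

End Eigenlines.

Lemma line_neq0 (U : {vspace 'cV[R]_2}) : is_line U -> U != 0%VS.
Proof. by move=> U1; rewrite -dimv_eq0 U1. Qed.

End ProjectionTiling.

(** A window that is open on the left and closed on the right becomes one of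
    the other kind when the sign of the height is changed. *)
Lemma half_open_window (R : realType) (a b : R) (Omega : set R) : a < b ->
  Omega = `[a, b[%classic \/ Omega = `]a, b]%classic ->
  exists (k a' b' : R), [/\ k = 1 \/ k = -1, a' < b', b' - a' = b - a &
    forall h, Omega h <-> a' <= k * h < b'].
Proof.
move=> ab [] ->.
  exists 1, a, b; split => //; [by left|by move=> h; rewrite mul1r /= in_itv].
exists (-1), (- b), (- a); split; [by right|by rewrite ltrN2|by ring|].
by move=> h; rewrite mulN1r lerN2 ltrN2 /= in_itv /= andbC.
Qed.

Theorem theorem2p1 (R : realType) (V W : {vspace 'cV[R]_2})
    (hV : is_line V) (hW : is_line W) (hVW : V <> W)
    (hVaxis : ~ axis_parallel V) (hWaxis : ~ axis_parallel W)
    (v : 'cV[R]_2) (hv : v \in V) (hv1 : unit_vector v)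
    (a b : R) (hab : a < b) (Omega : set R)
    (hOmega : Omega = `[a, b[%classic \/ Omega = `]a, b]%classic)
    (hnp : nonperiodic (projection_tiling V W Omega v)) :
  admits_substitution (projection_tiling V W Omega v) <->
  exists (M : 'M[int]_2) (lambda mu : R),
    [/\ GL2Z M /\ primitive_mx M,
        expanding_eigenvalue M lambda /\ contracting_eigenvalue M mu,
        V = passmx.leigenspace (real_action R M) lambda,
        W = passmx.leigenspace (real_action R M) mu
      & Q_adjoin lambda (b - a)].
Proof.
have [k [a' [b' [k1 ab' L' inO]]]] := half_open_window hab hOmega.
have k0 : k != 0 by case: k1 => ->; rewrite ?oppr_eq0 oner_eq0.
pose s : {additive lattice -> R} := along_form W v.
pose y : {additive lattice -> R} := height_form v k.
have tilingE : projection_tiling V W Omega v = [set s x | x in [set x | a' <= y x < b']].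
  rewrite (projection_tilingE hV hW hVW hVaxis hv hv1); congr (_ @` _).
  have yE x : y x = k * height_form v 1 x.
    by rewrite -[y x]/(height_form v k x) !height_formE mul1r.
  by apply/seteqP; split => x /=; rewrite yE => /inO.
have D0 : form_det s y != 0 := forms_det_neq0 hV hW hVW hVaxis hv hv1 k0.
rewrite tilingE in hnp; rewrite tilingE -L'; split.
  move=> /(substitution_automorphism D0 ab' hnp)[M [lam [mu]]].
  case=> -[detM primM] [lam1 mu1] sM yM [kap [p0 [kap0 kapL]]].
  have lm : lam != mu by apply: contraTneq lam1 => ->; rewrite -leNgt ltW.
  have [VE WE] := lines_of_eigenforms hV hW hVW hVaxis hv hv1 k0 lm sM yM.
  exists M, lam, mu; split => //.
    split; split => //; rewrite /passmx.leigenvalue.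
      by rewrite -VE line_neq0.
    by rewrite -WE line_neq0.
  have lamE := eigenvalue_slope hV hVaxis hv hv1 VE.
  have M01 := slope_coefficient_neq0 hV hVaxis hv hv1 VE detM lam1.
  have kZ : exists e : int, k = e%:~R by case: k1 => ->; [exists 1|exists (-1)].
  have [e kE] := kZ.
  apply: (integral_Q_adjoin lamE M01 kap0 (i := e * p0 1 0) (j := - (e * p0 0 0))).
  by rewrite kapL /y /= /height_form /coord_form kE rmorphN !intrM; ring.
case=> M [lam [mu [[detM _] [[_ lam1] [_ mu1]] VE WE QL]]].
have [sM yM] := eigenforms_of_lines hV hW hVW hVaxis hv hv1 VE WE k.
have sM' (x : lattice) : s (mulmx M x) = lam * s x := sM x.
have yM' (x : lattice) : y (mulmx M x) = mu * y x := yM x.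
have lamE := eigenvalue_slope hV hVaxis hv hv1 VE.
have [kap [i [j [kap0 kapL]]]] := Q_adjoin_integral lamE QL.
have y_inj := nonperiodic_inj D0 hnp.
have MK (x : lattice) : M *m (invmx M *m x) = x by rewrite mulKVmx // GL2Z_unitmx.
have kZ : exists e : int, k = e%:~R /\ e * e = 1.
  by case: k1 => ->; [exists 1|exists (-1)].
have [e [kE ee]] := kZ.
apply: (automorphism_substitution D0 y_inj lam1 mu1 sM' yM' MK
  (p0 := ux *~ (- (e * j)) + uy *~ (e * i)) ab' kap0).
have eeR : e%:~R * e%:~R = 1 :> R by rewrite -intrM ee.
rewrite kapL raddfD !(raddfMz y) /y /= /height_form /coord_form kE !mxE /=.
rewrite -(mulrzl _ (- _)) -(mulrzl _ (e * i)).
rewrite !(rmorphN, rmorphM) /=.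
transitivity (e%:~R * e%:~R * (i%:~R + j%:~R * slope v)); first by rewrite eeR mul1r.
ring.
Qed.
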